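(* The critical inverse temperature $\beta_c(T)$ of the Ising model on $T$ is constant $\mathsf{P}_{\mu_{cr}}$-almost surely; that is, there is a constant $c\in[0,\infty]$ such that $\beta_c(T)=c$ for $\mathsf{P}_{\mu_{cr}}$-almost every infinite Lorentzian triangulation $T\in\mathbb{LT}_\infty$.
   Context: **Lorentzian triangulations.** Let ${\sf C}=S^1\times[0,\infty)$ and ${\sf C}_N=S^1\times[0,N]$. A Lorentzian triangulation $T$ of ${\sf C}$ (resp. ${\sf C}_N$) is a connected graph $G$ (loops and multiple edges allowed, finitely or countably many vertices) embedded in the cylinder, all of whose faces are triangles (a face is a connected component of the complement of $G$; it is a triangle if its boundary meets precisely three edges), such that the graph and its triangles cover the cylinder, each triangle lies in some strip $S^1\times[j,j+1]$ and has all its vertices and exactly one of its edges on the boundary $(S^1\times\{j\})\cup(S^1\times\{j+1\})$ of the strip, and the number of edges on each circle $S^1\times\{j\}$ is positive and finite. Throughout there is exactly one edge on $S^1\times\{0\}$. The triangulation is rooted: it carries a root triangle with ordered vertices $(x,y,z)$, where the root vertex $x$ and the directed root edge $(x,y)$ lie on $S^1\times\{0\}$ (so here the root edge is a loop and $x=y$). Triangulations are considered up to homeomorphisms respecting the root vertex and the directed root edge. $\mathbb{LT}_\infty$ and $\mathbb{LT}_N$ denote the sets of such rooted Lorentzian triangulations of ${\sf C}$ and ${\sf C}_N$ respectively (the number of edges on the top circle of ${\sf C}_N$ is not fixed). **The measure $\mathsf{P}_{\mu_{cr}}$.** Let $F(T)$ be the number of triangles of $T\in\mathbb{LT}_N$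 and $\mathsf{P}_{N,\mu}(T)=e^{-\mu F(T)}/\sum_{T'\in\mathbb{LT}_N}e^{-\mu F(T')}$. Put $\mu_{cr}=\ln 2$. $\mathsf{P}_{\mu_{cr}}$ is the probability measure on $\mathbb{LT}_\infty$ that is the weak limit of $\mathsf{P}_{N,\mu_{cr}}$ as $N\to\infty$ (for each fixed $M$, the law of the restriction of the triangulation to ${\sf C}_M$ converges); this limit is known to exist. **Ising model.** For $T\in\mathbb{LT}_\infty$ let $T_N$ be its restriction to ${\sf C}_N$, $V(T_N)$ its vertex set, and $\partial T_N$ the set of vertices of $T$ on $S^1\times\{N+1\}$. Spins take values in $\{-1,1\}$. For a boundary configuration $\partial\sigma\in\{-1,1\}^{\partial T_N}$ and $\sigma\in\{-1,1\}^{V(T_N)}$ let $$H_N(\sigma|\partial\sigma)=-\sum_{\langle v,v'\rangle:\,v,v'\in V(T_N)}\sigma_v\sigma_{v'}-\sum_{\langle v,v'\rangle:\,v\in V(T_N),\,v'\in\partial T_N}\sigma_v\,\partial\sigma_{v'},$$ with sums over edges of $T$, and let $P^T_{N,\partial\sigma}(\sigma)$ be proportional to $\exp\{-\beta H_N(\sigma|\partial\sigma)\}$. A Gibbs measure for the Ising model on $T$ at inverse temperature $\beta$ is a probability measure on $\{-1,1\}^{V(T)}$ (product $\sigma$-algebra) that is a weak limit, along some subsequence of $N\to\infty$, of measures $P^T_{N,\partial\sigma}$ for some sequence of boundary conditions $\partial\sigma$. **Critical value.** It is known that on any locally finite graph at least one Gibbs measure exists for every $\beta\ge 0$, and that existence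 of more than one Gibbs measure is monotone increasing in $\beta$. $\beta_c(T)\in[0,\infty]$ is the critical value such that there is a unique Gibbs measure for $\beta<\beta_c(T)$ and there are multiple Gibbs measures for $\beta>\beta_c(T)$, i.e. $\beta_c(T)=\sup\{\beta\ge0:\text{the Gibbs measure on } T \text{ at inverse temperature }\beta\text{ is unique}\}$. *)

(* Defs.v *)
From HB Require Import structures.
From mathcomp Require Import all_boot all_order all_algebra.
From mathcomp Require Import all_classical all_reals all_analysis.

Set Implicit Arguments.
Unset Strict Implicit.
Unset Printing Implicit Defensive.

Import Order.TTheory GRing.Theory Num.Theory.
Import numFieldNormedType.Exports.
Local Open Scope classical_set_scope.
Local Open Scope ring_scope.

(******************************************************************************)
(* Rooted Lorentzian triangulations up to rooted homeomorphism.               *)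
(*                                                                            *)
(* The triangles of the strip S^1 x [j, j+1] form a cyclic sequence, each     *)
(* sharing a crossing edge with the next one, and each is either "up" (its    *)
(* horizontal edge lies on S^1 x {j}) or "down" (its horizontal edge lies on  *)
(* S^1 x {j+1}). The strip is encoded by the word of its triangles, true for  *)
(* up and false for down, read in the direction of the root edge and starting *)
(* from the up triangle sitting on the root edge of S^1 x {j}. The root edge  *)
(* of S^1 x {0} is its only edge. If (x, y, z) is the triangle that starts    *)
(* the word of the strip j, with (x, y) the root edge of S^1 x {j}, then z is *)
(* the root vertex of S^1 x {j+1}, and the root edge of S^1 x {j+1} leaves z  *)
(* in the common direction. No choice is involved, so a rooted triangulation, *)
(* taken up to homeomorphisms respecting its root, is the same thing as a     *)
(* sequence of words in which each word starts with true, contains false (the *)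
(* circle S^1 x {j+1} has an edge), and has as many letters false as the next *)
(* word has letters true (edges of their common circle).                      *)
(******************************************************************************)

Definition ups (w : seq bool) : nat := count id w.
Definition downs (w : seq bool) : nat := count negb w.

Definition strip_ok (w : seq bool) : bool := head false w && (0 < downs w)%N.

Definition lorentzian (s : seq (seq bool)) : bool :=
  [&& all strip_ok s,
      sorted [rel v w | downs v == ups w] s
    & ups (head [:: true] s) == 1%N].

(* Triangulations of S^1 x [0, N]. *)
Record LTfin (N : nat) := MkLTfin {
  strips : N.-tuple (seq bool);
  stripsP : lorentzian strips }.

HB.instance Definition _ N := [isSub for @strips N].
HB.instance Definition _ N := [Countable of LTfin N by <:].

(* Triangulations of S^1 x [0, oo[. *)
Record LT := MkLT {
  strip :> nat -> seq bool;
  stripP : forall N, lorentzian (mkseq strip N) }.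

HB.instance Definition _ := gen_eqMixin LT.
HB.instance Definition _ := gen_choiceMixin LT.

Lemma thin_LT_subproof N : lorentzian (mkseq (fun=> [:: true; false]) N).
Proof.
rewrite /lorentzian; apply/and3P; split; last by case: N.
  by apply/allP => w /mapP[j _ ->].
by rewrite sorted_map; case: N => // N; elim: N 0%N => //= N IH m; apply: IH.
Qed.

HB.instance Definition _ := isPointed.Build LT (MkLT thin_LT_subproof).

Definition restr (M : nat) (T : LT) : LTfin M :=
  @MkLTfin M [tuple of mkseq T M] (stripP T M).

Definition LT_cylinders : set (set LT) :=
  [set A | exists M (t : LTfin M), A = [set T | restr M T = t]].

Definition LTmeas := g_sigma_algebraType LT_cylinders.

Section triangulation_measures.
Variable R : realType.

Definition nb_triangles N (t : LTfin N) : nat :=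
  (\sum_(w <- strips t) size w)%N.

Definition LT_weight N (mu : R) (t : LTfin N) : R :=
  expR (- mu * (nb_triangles t)%:R).

Definition LT_partition N (mu : R) : \bar R :=
  (\esum_(t in [set: LTfin N]) (LT_weight mu t)%:E)%E.

Definition LT_prob N (mu : R) (A : set (LTfin N)) : \bar R :=
  (\esum_(t in A) (LT_weight mu t / fine (LT_partition N mu))%:E)%E.

Definition mu_cr : R := ln 2.

(* Since LTfin M is countable and discrete, the convergence in law of the     *)
(* restrictions to S^1 x [0, M] is the convergence of their point masses.     *)
Definition is_LT_weak_limit (mu : R) (P : probability LTmeas R) : Prop :=
  forall M (t : LTfin M),
    LT_prob mu [set t' : LTfin N | take M (strips t') = strips t]
      @[N --> \oo] --> P [set T | restr M T = t].

End triangulation_measures.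

(******************************************************************************)
(* The graph of T. Its vertex (j, i) is the start of the i-th edge of the     *)
(* circle S^1 x {j}, counted from the root edge. Parallel edges and loops are *)
(* kept: the edges form a type of their own, with endpoints.                  *)
(******************************************************************************)

Section graph.
Variable T : LT.

Definition width (j : nat) : nat := ups (T j).

Lemma width_gt0 j : (0 < width j)%N.
Proof.
have /and3P[/allP ok _ _] := stripP T j.+1.
have /ok/andP[] : T j \in mkseq T j.+1.
  by apply: map_f; rewrite mem_iota ltnS leqnn.
by rewrite /width; case: (T j) => // -[].
Qed.

Lemma downs_width j : downs (T j) = width j.+1.
Proof.
have /and3P[_ /(sortedP [::])/(_ j) + _] := stripP T j.+2.
by rewrite size_mkseq !nth_mkseq//= => /(_ (ltnSn _))/eqP.
Qed.

Lemma width0 : width 0 = 1%N.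
Proof. by have /and3P[_ _ /eqP] := stripP T 1. Qed.

Definition V : Type := {j : nat & 'I_(width j)}.

Definition level (v : V) : nat := tag v.

Definition vert (j k : nat) : V :=
  Tagged (fun j => 'I_(width j)) (Ordinal (ltn_pmod k (width_gt0 j))).

(* inl (j, i) is the i-th horizontal edge on S^1 x {j}; inr (j, p) is the     *)
(* edge crossing the strip j on the left of its p-th triangle.                *)
Definition E : Type :=
  ({j : nat & 'I_(width j)} + {j : nat & 'I_(size (T j))})%type.

(* The p-th crossing edge of the strip j has p triangles between it and the   *)
(* 0-th one, of which the up ones each use an edge of S^1 x {j} and the down  *)
(* ones an edge of S^1 x {j+1}. The lower end of a crossing edge comes first. *)
Definition crossing_ends (j p : nat) : V * V :=
  (vert j (ups (take p (T j))), vert j.+1 (downs (take p (T j)))).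

Definition ends (e : E) : V * V :=
  match e with
  | inl (existT j i) => (vert j i, vert j i.+1)
  | inr (existT j p) => crossing_ends j p
  end.

Lemma vert_modn j k : vert j (k %% width j) = vert j k.
Proof. by congr Tagged; apply: val_inj; rewrite /= modn_mod. Qed.

(* The faces are the triangles they should be: the two crossing edges         *)
(* bounding the p-th triangle of the strip j share an end, and their other    *)
(* ends are the two ends of its horizontal edge.                              *)
Lemma face_ends j p : (p < size (T j))%N ->
  let: (u, d) := (ups (take p (T j)), downs (take p (T j))) in
  crossing_ends j p = (vert j u, vert j.+1 d) /\
  crossing_ends j (p.+1 %% size (T j)) =
    if nth false (T j) p then (vert j u.+1, vert j.+1 d)
    else (vert j u, vert j.+1 d.+1).
Proof.
move=> ltp; split=> //.
have -> : crossing_ends j (p.+1 %% size (T j)) = crossing_ends j p.+1.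
  have [lts|] := ltnP p.+1 (size (T j)); first by rewrite modn_small.
  move=> ges; have -> : p.+1 = size (T j) by apply/eqP; rewrite eqn_leq ltp.
  rewrite modnn /crossing_ends take0 take_size downs_width.
  by rewrite -/(width j) -(vert_modn _ (width j)) -(vert_modn _ (width j.+1)) !modnn.
rewrite /crossing_ends (take_nth false ltp) /ups /downs -!cats1 !count_cat /=.
by case: nth; rewrite /= !(addn0, addn1).
Qed.

End graph.

(******************************************************************************)
(* The Ising model on T; the spin +1 is encoded by true, and -1 by false.     *)
(******************************************************************************)

Section ising.
Variables (R : realType) (T : LT).

Definition config := V T -> bool.

Definition spin (b : bool) : R := if b then 1 else -1.

Definition inner_edges (N : nat) : set (E T) :=
  [set e | (level (ends e).1 <= N)%N /\ (level (ends e).2 <= N)%N].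

(* The edges from V(T_N) to the circle S^1 x {N+1}; the first end of an edge  *)
(* never lies above the second one.                                           *)
Definition outer_edges (N : nat) : set (E T) :=
  [set e | (level (ends e).1 <= N)%N /\ level (ends e).2 = N.+1].

Definition hamiltonian (N : nat) (s b : config) : R :=
  - \sum_(e \in inner_edges N) (spin (s (ends e).1) * spin (s (ends e).2))
  - \sum_(e \in outer_edges N) (spin (s (ends e).1) * spin (b (ends e).2)).

(* {-1,1}^V(T_N) is realized as the finite set of the configurations on V(T)  *)
(* that coincide with b off V(T_N), so that the finite-volume measures all    *)
(* live on {-1,1}^V(T). The boundary condition is the restriction of b to     *)
(* S^1 x {N+1}: the values of b above it play no role in the weak limits.     *)
Definition volume (N : nat) (b : config) : set config :=
  [set s | forall v, (N < level v)%N -> s v = b v].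

Definition ising_weight (beta : R) (N : nat) (b s : config) : R :=
  expR (- beta * hamiltonian N s b).

Definition ising_expectation (beta : R) (N : nat) (b : config)
    (f : config -> R) : R :=
  (\sum_(s \in volume N b) f s * ising_weight beta N b s) /
  (\sum_(s \in volume N b) ising_weight beta N b s).

Definition spin_cylinders : set (set config) :=
  [set A | exists v, A = [set s | s v = true]].

Definition configmeas := g_sigma_algebraType spin_cylinders.

(* Weak convergence is tested on the continuous functions on the compact      *)
(* space {-1,1}^V(T), with its product topology.                              *)
Definition gibbs (beta : R) (G : probability configmeas R) : Prop :=
  exists (phi : nat -> nat) (b : nat -> config),
    {homo phi : m n / (m < n)%N} /\
    forall f : {ptws V T -> bool} -> R, continuous f ->
      (ising_expectation beta (phi k) (b k) f)%:E @[k --> \oo]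
        --> (\int[G]_s (f s)%:E)%E.

Definition unique_gibbs (beta : R) : Prop :=
  exists G : probability configmeas R, gibbs beta G /\
    forall G' : probability configmeas R, gibbs beta G' ->
      forall A : set configmeas, measurable A -> G' A = G A.

Definition beta_c : \bar R :=
  ereal_sup [set beta%:E | beta in [set beta | 0 <= beta /\ unique_gibbs beta]].

End ising.

(* Main.v *)
Require Import Defs.
From HB Require Import structures.
From mathcomp Require Import all_boot all_order all_algebra.
From mathcomp Require Import all_classical all_reals all_analysis.
From mathcomp Require Import measurable_realfun ring lra.
Import Order.TTheory GRing.Theory Num.Theory.
Import numFieldNormedType.Exports.
Local Open Scope classical_set_scope.
Local Open Scope ring_scope.

(* Write gap for the difference of the expectations of a spin under the + and - boundary
   conditions. By the FKG inequality the finite-volume expectations are monotone in the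
   boundary condition, so they converge under + and under -, and the Gibbs measure is unique
   if and only if the gap of every vertex tends to 0. By Ginibre's inequality the gap
   increases with beta, so uniqueness at beta passes to smaller inverse temperatures, and
   beta_c is determined by the rational ones. For a fixed beta, uniqueness is a measurable
   property of T. It does not depend on finitely many strips of T, since changing them
   reweights the model by a positive function of finitely many spins. It thus remains to
   prove that tail events have probability 0 or 1.

   A strip with m lower edges is a word in which each true is followed by a block of false,
   so a triangulation is the tree of a Galton-Watson process with offspring law 2^-(a+1), and
   in the limit a triangulation t of height M whose top circle has m edges has probability
   m 2^-(number of triangles of t). For a tail event A, P(A and t) 2^(number of triangles
   of t) is a function a(M, m), and a(M, .) is the image of a(M + 1, .) under one generation
   of the process. Over k generations an ancestor dies out with probability k / (k + 1), so
   a(M, x + y) >= a(M, x) q^y + q^x a(M, y) with q = k / (k + 1), hence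
   a(M, m) >= m a(M, 1). As the same holds for the complement of A and the two functions add
   up to m, there is equality: A is independent of the first strips, hence of itself. *)

Set Implicit Arguments.
Unset Strict Implicit.
Unset Printing Implicit Defensive.

(** * Finite Ising models *)

Section spin_sums.
Context {R : realType} {S : eqType}.
Implicit Types (s t : S -> bool) (l : seq S) (F G : (S -> bool) -> R).

Definition set_spin s v c : S -> bool := fun u => if u == v then c else s u.

(** Only the spins listed in [l] are summed over. Elsewhere the configuration keeps the values of
    [s], which thus acts as the boundary condition. *)
Fixpoint spinsum l F s : R :=
  if l is v :: l' then spinsum l' F (set_spin s v true) + spinsum l' F (set_spin s v false)
  else F s.

Lemma spinsum_cat l1 l2 F s :
  spinsum (l1 ++ l2) F s = spinsum l1 (spinsum l2 F) s.
Proof. by elim: l1 s => //= v l IH s; rewrite !IH. Qed.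

Lemma eq_spinsum l F G s : F =1 G -> spinsum l F s = spinsum l G s.
Proof. by move=> /funext ->. Qed.

Lemma spinsumD l F G s :
  spinsum l (fun t => F t + G t) s = spinsum l F s + spinsum l G s.
Proof. by elim: l s => //= v l IH s; rewrite !IH addrACA. Qed.

Lemma spinsumZ l c F s : spinsum l (fun t => c * F t) s = c * spinsum l F s.
Proof. by elim: l s => //= v l IH s; rewrite !IH mulrDr. Qed.

Lemma spinsumZr l c F s : spinsum l (fun t => F t * c) s = spinsum l F s * c.
Proof. by elim: l s => //= v l IH s; rewrite !IH mulrDl. Qed.

Lemma spinsumB l F G s :
  spinsum l (fun t => F t - G t) s = spinsum l F s - spinsum l G s.
Proof.
rewrite spinsumD; congr (_ + _); rewrite -mulN1r -spinsumZ.
by apply: eq_spinsum => t; rewrite mulN1r.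
Qed.

(** Only configurations with boundary condition [s] are compared. Used in both directions, this
    replaces a summand by one that equals it under that boundary condition alone. *)
Lemma le_spinsum l F G s :
  (forall t, (forall u, u \notin l -> t u = s u) -> F t <= G t) ->
  spinsum l F s <= spinsum l G s.
Proof.
elim: l s => [|v l IH] s /= FG; first exact: FG.
by apply: lerD; apply: IH => t ts; apply: FG => u;
  rewrite inE negb_or => /andP[uv ul]; rewrite ts// /set_spin (negbTE uv).
Qed.

Lemma spinsum_ge0 l F s : (forall t, 0 <= F t) -> 0 <= spinsum l F s.
Proof. by move=> F0; elim: l s => //= v l IH s; rewrite addr_ge0. Qed.

Lemma spinsum_gt0 l F s : (forall t, 0 < F t) -> 0 < spinsum l F s.
Proof. by move=> F0; elim: l s => //= v l IH s; rewrite addr_gt0. Qed.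

Lemma spinsum_exchange l l' (F : (S -> bool) -> (S -> bool) -> R) s t :
  spinsum l (fun s' => spinsum l' (F s') t) s =
  spinsum l' (fun t' => spinsum l (F^~ t') s) t.
Proof.
elim: l s => //= v l IH s; rewrite !IH -spinsumD.
by apply: eq_spinsum.
Qed.

Definition depends_on (D : {pred S}) {X : Type} (F : (S -> bool) -> X) :=
  forall s t, {in D, s =1 t} -> F s = F t.

Lemma dep_sub (D D' : {pred S}) X (F : (S -> bool) -> X) :
  {subset D <= D'} -> depends_on D F -> depends_on D' F.
Proof. by move=> sD dF s t st; apply: dF => v /sD; apply: st. Qed.

Lemma dep_spinsum (D : {pred S}) l F :
  depends_on D F -> depends_on [pred v | (v \in D) && (v \notin l)] (spinsum l F).
Proof.
move=> dF; elim: l => [|v l IH] s t st /=.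
  by apply: dF => u uD; apply: st; rewrite inE uD.
congr (_ + _); apply: IH => u /andP[uD ul]; rewrite /set_spin;
  by case: eqP => // /eqP uv; apply: st; rewrite !inE uD negb_or uv ul.
Qed.

Lemma spinsum_mull l F G s :
  (forall t u, (forall v, v \notin l -> t v = u v) -> F t = F u) ->
  spinsum l (fun t => F t * G t) s = F s * spinsum l G s.
Proof.
elim: l s => //= v l IH s FP.
have FP' t u : (forall v0, v0 \notin l -> t v0 = u v0) -> F t = F u.
  by move=> tu; apply: FP => w; rewrite inE negb_or => /andP[_]; apply: tu.
by rewrite !IH// -!(FP s (set_spin s v _)) ?mulrDr// => w;
  rewrite inE negb_or /set_spin => /andP[/negbTE ->].
Qed.

(* Pointwise product of spins, true standing for +1. *)
Definition spinmul s t : S -> bool := fun v => s v == t v.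

(** Multiplication by [s] keeps or swaps the two values of each spin, so it permutes the
    configurations that are summed. *)
Lemma spinsum_mul l F s t :
  spinsum l F t = spinsum l (fun x => F (spinmul s x)) (spinmul s t).
Proof.
elim: l t => [|v l IH] t /=.
  by congr F; apply/funext => v; rewrite /spinmul; case: (s v); case: (t v).
have updE c : spinmul s (set_spin t v c) = set_spin (spinmul s t) v (s v == c).
  by apply/funext => u; rewrite /spinmul /set_spin; case: (u =P v) => // ->.
by rewrite !IH !updE; case: (s v) => //=; rewrite addrC.
Qed.

Lemma eq_spinsum_base l F s t :
  (forall u, u \notin l -> s u = t u) -> spinsum l F s = spinsum l F t.
Proof.
elim: l s t => [|v l IH] s t st /=; first by congr F; apply/funext => u; exact: st.
by congr (_ + _); apply: IH => u ul; rewrite /set_spin; case: eqP => // /eqP uv;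
  apply: st; rewrite inE negb_or uv.
Qed.

End spin_sums.

Lemma spinsum_map {R : realType} {S S' : eqType} (i : S -> S') (l : seq S)
    (F : (S -> bool) -> R) (s : S' -> bool) : injective i ->
  spinsum (map i l) (fun t => F (t \o i)) s = spinsum l F (s \o i).
Proof.
move=> inj; elim: l s => //= v l IH s; rewrite !IH.
have E c : set_spin s (i v) c \o i = set_spin (s \o i) v c.
  by apply/funext => u; rewrite /set_spin /= (inj_eq inj).
by rewrite !E.
Qed.

(** * The Ahlswede-Daykin four functions inequality *)

Section ahlswede_daykin.
Context {R : realType} {S : eqType}.
Implicit Types (s t : S -> bool) (l : seq S) (F G : (S -> bool) -> R).

Definition spinor s t : S -> bool := fun v => s v || t v.
Definition spinand s t : S -> bool := fun v => s v && t v.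
Definition spinle s t := forall v, s v ==> t v.

(** This is the four functions inequality for a single spin, the index being the value of the
    spin. *)
Lemma four_numbers (a0 a1 b0 b1 c0 c1 d0 d1 : R) :
  0 <= a0 -> 0 <= a1 -> 0 <= b0 -> 0 <= b1 ->
  0 <= c0 -> 0 <= c1 -> 0 <= d0 -> 0 <= d1 ->
  a0 * b0 <= c0 * d0 -> a0 * b1 <= c1 * d0 -> a1 * b0 <= c1 * d0 ->
  a1 * b1 <= c1 * d1 -> (a0 + a1) * (b0 + b1) <= (c0 + c1) * (d0 + d1).
Proof.
move=> a00 a10 b00 b10 c00 c10 d00 d10 h00 h01 h10 h11.
(* If c1 d0 = 0, both mixed products vanish; otherwise one may divide by c1 d0. *)
have [t0|t0] := leP (c1 * d0) 0.
  have ct : c1 * d0 = 0 by apply/eqP; rewrite eq_le t0 mulr_ge0.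
  have h01' : a0 * b1 = 0 by apply/eqP; rewrite eq_le mulr_ge0// -ct h01.
  have h10' : a1 * b0 = 0 by apply/eqP; rewrite eq_le mulr_ge0// -ct h10.
  rewrite !mulrDl !mulrDr h01' h10' ct.
  have := mulr_ge0 c00 d10; lra.
have c1p : 0 < c1 by rewrite lt_neqAle eq_sym c10 andbT; apply: contraTneq t0 => ->;
  rewrite mul0r ltxx.
have d0p : 0 < d0 by rewrite lt_neqAle eq_sym d00 andbT; apply: contraTneq t0 => ->;
  rewrite mulr0 ltxx.
(* With t = c1 d0 and u, v the mixed products, u v <= (c0 d0) (c1 d1) and
   (t - u) (t - v) >= 0 give u + v <= t + c0 d1. *)
have uv : (a0 * b1) * (a1 * b0) <= (c0 * d1) * (c1 * d0).
  have := ler_pM (mulr_ge0 a00 b00) (mulr_ge0 a10 b10) h00 h11.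
  by rewrite -(mulrA a0) -(mulrA c0); nra.
have : (a0 * b1 + a1 * b0) * (c1 * d0) <= (c1 * d0 + c0 * d1) * (c1 * d0).
  have : 0 <= (c1 * d0 - a0 * b1) * (c1 * d0 - a1 * b0).
    by apply: mulr_ge0; rewrite subr_ge0.
  nra.
rewrite ler_pM2r// => ?; nra.
Qed.

Lemma ahlswede_daykin l F1 F2 F3 F4 :
  (forall s, 0 <= F1 s) -> (forall s, 0 <= F2 s) ->
  (forall s, 0 <= F3 s) -> (forall s, 0 <= F4 s) ->
  (forall s t, F1 s * F2 t <= F3 (spinor s t) * F4 (spinand s t)) ->
  forall s t, spinsum l F1 s * spinsum l F2 t <=
    spinsum l F3 (spinor s t) * spinsum l F4 (spinand s t).
Proof.
move=> p1 p2 p3 p4 h; elim: l => [|v l IH] s t //=.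
have o c d : set_spin (spinor s t) v (c || d) = spinor (set_spin s v c) (set_spin t v d).
  by apply/funext => u; rewrite /spinor /set_spin; case: eqP.
have a c d : set_spin (spinand s t) v (c && d) = spinand (set_spin s v c) (set_spin t v d).
  by apply/funext => u; rewrite /spinand /set_spin; case: eqP.
(* The value false of the spin at [v] becomes the index 0, and true the index 1. *)
rewrite ![_ _ (set_spin _ v true) + _]addrC; apply: four_numbers;
  do ?exact: spinsum_ge0.
- by rewrite (o false false) (a false false).
- by rewrite (o false true) (a false true).
- by rewrite (o true false) (a true false).
- by rewrite (o true true) (a true true).
Qed.

End ahlswede_daykin.

(** * Boltzmann averages and the FKG inequality *)

Section ising_finite.
Context {R : realType} {S : eqType}.
Implicit Types (s t : S -> bool) (l : seq S) (es : seq (S * S)).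
Implicit Types (F G : (S -> bool) -> R) (beta : R).

Definition energy es s : R := \sum_(e <- es) spin R (s e.1) * spin R (s e.2).
Definition boltz beta es s : R := expR (beta * energy es s).
Definition avg beta es l F s : R :=
  spinsum l (fun t => F t * boltz beta es t) s / spinsum l (boltz beta es) s.

Lemma boltz_gt0 beta es s : 0 < boltz beta es s.
Proof. exact: expR_gt0. Qed.

Lemma boltz_cat beta es1 es2 s :
  boltz beta (es1 ++ es2) s = boltz beta es1 s * boltz beta es2 s.
Proof. by rewrite /boltz /energy big_cat/= mulrDr expRD. Qed.

Lemma partition_gt0 beta es l s : 0 < spinsum l (boltz beta es) s.
Proof. by apply: spinsum_gt0 => t; exact: boltz_gt0. Qed.

Lemma avgD beta es l F G s :
  avg beta es l (fun t => F t + G t) s = avg beta es l F s + avg beta es l G s.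
Proof.
rewrite /avg -mulrDl -spinsumD; congr (_ / _).
by apply: eq_spinsum => t; rewrite mulrDl.
Qed.

Lemma avgZ beta es l c F s : avg beta es l (fun t => c * F t) s = c * avg beta es l F s.
Proof.
rewrite /avg mulrA -spinsumZ; congr (_ / _).
by apply: eq_spinsum => t; rewrite mulrA.
Qed.

Lemma avg_cst beta es l c s : avg beta es l (fun=> c) s = c.
Proof. by rewrite /avg spinsumZ mulfK// gt_eqF// partition_gt0. Qed.

Lemma avgB beta es l F G s :
  avg beta es l (fun t => F t - G t) s = avg beta es l F s - avg beta es l G s.
Proof.
rewrite avgD -mulN1r -avgZ; congr (_ + avg _ _ _ _ _).
by apply/funext => t; rewrite mulN1r.
Qed.

Lemma le_avg beta es l F G s : (forall t, F t <= G t) ->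
  avg beta es l F s <= avg beta es l G s.
Proof.
move=> FG; rewrite ler_pM2r ?invr_gt0 ?partition_gt0//.
by apply: le_spinsum => t _; rewrite ler_pM2r ?boltz_gt0.
Qed.

Lemma avg_sum (I : Type) (r : seq I) (c : I -> R) (F : I -> (S -> bool) -> R) beta es l s :
  avg beta es l (fun t => \sum_(i <- r) c i * F i t) s =
  \sum_(i <- r) c i * avg beta es l (F i) s.
Proof.
elim: r => [|i r IH].
  by rewrite big_nil -[RHS](avg_cst beta es l 0 s); congr avg; apply/funext => t; rewrite big_nil.
rewrite big_cons -IH -avgZ -avgD; congr avg; apply/funext => t; by rewrite big_cons.
Qed.

Definition increasing F := forall s t, spinle s t -> F s <= F t.

(** The inequality holds edge by edge, by inspection of the sixteen values of the spins. *)
Lemma energy_supermodular es s t :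
  energy es s + energy es t <= energy es (spinor s t) + energy es (spinand s t).
Proof.
rewrite /energy -!big_split/=; apply: ler_sum => -[u v] _ /=.
rewrite /spinor /spinand /spin.
by case: (s u); case: (s v); case: (t u); case: (t v) => /=; lra.
Qed.

(* FKG: a boundary condition with more spins + dominates. It is the Ahlswede-Daykin
   inequality for F * boltz and boltz, supermodularity of the energy being its hypothesis. *)
Lemma avg_mono beta es l F s t : 0 <= beta ->
  (forall u, 0 <= F u) -> increasing F -> spinle s t ->
  avg beta es l F s <= avg beta es l F t.
Proof.
move=> b0 F0 incF st.
rewrite /avg ler_pdivrMr ?partition_gt0// mulrAC ler_pdivlMr ?partition_gt0//.
have W0 u : 0 <= boltz beta es u by exact: ltW (boltz_gt0 _ _ _).
have andE : spinand s t = s.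
  by apply/funext => v; rewrite /spinand; have := st v; case: (s v) => // /= ->.
have orE : spinor s t = t.
  by apply/funext => v; rewrite /spinor; have := st v; case: (s v).
pose FW u := F u * boltz beta es u.
have := @ahlswede_daykin _ _ l FW (boltz beta es) FW (boltz beta es).
rewrite /FW => /(_ _ _ _ _ _ s t); rewrite andE orE; apply => //;
  try by move=> u; rewrite mulr_ge0.
move=> x y; rewrite -!mulrA; apply: ler_pM => //; rewrite ?mulr_ge0//.
  by apply: incF => v; rewrite /spinor; case: (x v).
by rewrite /boltz -!expRD ler_expR -!mulrDr ler_wpM2l// energy_supermodular.
Qed.

End ising_finite.

(** * The inequalities of Griffiths and Ginibre *)

Section griffiths.
Context {R : realType} {S : eqType}.
Implicit Types (s t : S -> bool) (l A : seq S) (es : seq (S * S)).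
Implicit Types (F G : (S -> bool) -> R).

Definition character A s : R := \prod_(v <- A) spin R (s v).

(** The cone generated by the products of spins. It is closed under sums, products and summation
    over a spin, it contains the ferromagnetic weights, and its members are nonnegative at the
    all-plus configuration. *)
Definition poscomb F := exists2 L : seq (R * seq S),
  {in L, forall p, 0 <= p.1} & F = fun s => \sum_(p <- L) p.1 * character p.2 s.

Lemma poscombD F G : poscomb F -> poscomb G -> poscomb (fun s => F s + G s).
Proof.
move=> [L L0 ->] [L' L'0 ->]; exists (L ++ L').
  by move=> p; rewrite mem_cat => /orP[/L0|/L'0].
by apply/funext => s; rewrite big_cat.
Qed.

Lemma poscombM F G : poscomb F -> poscomb G -> poscomb (fun s => F s * G s).
Proof.
move=> [L L0 ->] [L' L'0 ->].
exists [seq (p.1 * q.1, p.2 ++ q.2) | p <- L, q <- L'].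
  by move=> _ /allpairsP[[p q] [/= /L0 p0 /L'0 q0 ->]]; exact: mulr_ge0.
apply/funext => s; rewrite mulr_suml big_allpairs_dep/=; apply: eq_bigr => p _.
rewrite mulr_sumr; apply: eq_bigr => q _.
by rewrite /character big_cat/= mulrACA.
Qed.

Lemma poscomb_character A c : 0 <= c -> poscomb (fun s => c * character A s).
Proof.
move=> c0; exists [:: (c, A)]; first by move=> p; rewrite inE => /eqP ->.
by apply/funext => s; rewrite big_seq1.
Qed.

Lemma poscomb_cst c : 0 <= c -> poscomb (fun=> c).
Proof.
move=> /(poscomb_character [::]); congr poscomb; apply/funext => s.
by rewrite /character big_nil mulr1.
Qed.

Lemma poscomb_spin v : poscomb (fun s => spin R (s v)).
Proof.
have := poscomb_character [:: v] ler01; congr poscomb; apply/funext => s.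
by rewrite mul1r /character big_seq1.
Qed.

(** For x = 1 or -1, exp(K x) = cosh K + x sinh K; here [a] is cosh K and [b] is sinh K. *)
Lemma poscomb_expR u v K : 0 <= K ->
  poscomb (fun s => expR (K * (spin R (s u) * spin R (s v)))).
Proof.
move=> K0; have K1 : expR (- K) <= expR K by rewrite ler_expR; lra.
pose a := (expR K + expR (- K)) / 2; pose b := (expR K - expR (- K)) / 2.
have a0 : 0 <= a by rewrite divr_ge0// addr_ge0// expR_ge0.
have b0 : 0 <= b by rewrite divr_ge0// subr_ge0.
have := poscombD (poscomb_cst a0)
  (poscombM (poscomb_cst b0) (poscombM (poscomb_spin u) (poscomb_spin v))).
congr poscomb; apply/funext => s; rewrite /a /b /spin.
by case: (s u); case: (s v); rewrite ?(mulr1, mulrN1, mulrN, opprK); field.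
Qed.

Lemma poscomb_prod (I : Type) (r : seq I) (f : I -> (S -> bool) -> R) :
  (forall i, poscomb (f i)) -> poscomb (fun s => \prod_(i <- r) f i s).
Proof.
move=> fp; elim: r => [|i r IH].
  have := poscomb_cst ler01; congr poscomb.
  by apply/funext => s; rewrite big_nil.
have := poscombM (fp i) IH; congr poscomb.
by apply/funext => s; rewrite big_cons.
Qed.

Lemma character_upd A s v c : character A (set_spin s v c) =
  spin R c ^+ count_mem v A * character ([seq u <- A | u != v]) s.
Proof.
elim: A => [|u A IH]; first by rewrite /character !big_nil mulr1.
rewrite /character big_cons -/(character A _) IH /= /set_spin.
case: eqP => [_|_] /=; first by rewrite exprS -!mulrA.
by rewrite add0n big_cons -/(character _ s) mulrCA.
Qed.

(** Summing over the spin at [v] doubles the products that contain [v] an even number of times and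
    cancels the others. *)
Lemma poscomb_flip F v : poscomb F ->
  poscomb (fun s => F (set_spin s v true) + F (set_spin s v false)).
Proof.
move=> [L L0 ->].
exists [seq (p.1 * (1 + (-1) ^+ count_mem v p.2), [seq u <- p.2 | u != v]) | p <- L].
  move=> _ /mapP[p /L0 p0 ->] /=; apply: mulr_ge0 => //.
  by rewrite -signr_odd; case: odd; rewrite ?expr1 ?expr0; lra.
apply/funext => s; rewrite big_map -big_split/=; apply: eq_bigr => p _.
by rewrite !character_upd /= expr1n; ring.
Qed.

Lemma poscomb_spinsum F l : poscomb F -> poscomb (spinsum l F).
Proof.
elim: l => // v l IH /IH Fp; exact: poscomb_flip Fp.
Qed.

Lemma poscomb_ge0 F : poscomb F -> 0 <= F (fun=> true).
Proof.
move=> [L L0 ->]; rewrite big_seq; apply: sumr_ge0 => p /L0 p0.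
by rewrite mulr_ge0//; apply: prodr_ge0 => v _; exact: ler01.
Qed.

(** A Boltzmann weight whose coupling varies with the edge, as occurs in Ginibre's duplicated
    system. *)
Definition aligned es (K : S * S -> R) s :=
  \prod_(e <- es) expR (K e * (spin R (s e.1) * spin R (s e.2))).

Lemma boltz_prod beta es s : boltz beta es s = aligned es (fun=> beta) s.
Proof.
rewrite /aligned /boltz /energy; elim: es => [|e es IH].
  by rewrite !big_nil mulr0 expR0.
by rewrite !big_cons mulrDr expRD IH.
Qed.

Lemma griffiths1 es K l v : (forall e, 0 <= K e) ->
  0 <= spinsum l (fun s => spin R (s v) * aligned es K s) (fun=> true).
Proof.
move=> K0; apply/poscomb_ge0/poscomb_spinsum/poscombM; first exact: poscomb_spin.
by apply: poscomb_prod => e; exact: poscomb_expR.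
Qed.

Lemma spin_mul b c : spin R (b == c) = spin R b * spin R c.
Proof. by case: b; case: c; rewrite /spin /= ?(mulr1, mul1r, mulrN1) ?opprK. Qed.

(* Ginibre's duplicated system: with t = s * x, the summand factors as (1 - x_v) s_v times
   a ferromagnetic weight in s. *)
Lemma ginibre beta beta' es l v : 0 <= beta <= beta' ->
  0 <= spinsum l (fun s => spinsum l (fun t =>
    (spin R (s v) - spin R (t v)) * (boltz beta' es s * boltz beta es t))
    (fun=> true)) (fun=> true).
Proof.
move=> /andP[b0 bb'].
(* Since [s] is + off [l], the substitution t = s x leaves the boundary condition of [x] equal to
   +. *)
have E s : (forall u, u \notin l -> s u = true) ->
    spinsum l (fun t => (spin R (s v) - spin R (t v)) *
      (boltz beta' es s * boltz beta es t)) (fun=> true) =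
    spinsum l (fun x => (1 - spin R (x v)) * (spin R (s v) *
      aligned es (fun e => beta' + beta * (spin R (x e.1) * spin R (x e.2))) s))
      (fun=> true).
  move=> sT; rewrite (spinsum_mul _ _ s).
  rewrite (@eq_spinsum_base _ _ _ _ _ (fun=> true)); last first.
    by move=> u /sT su; rewrite /spinmul su.
  apply: eq_spinsum => x; rewrite /spinmul spin_mul !boltz_prod.
  have -> : aligned es (fun e => beta' + beta * (spin R (x e.1) * spin R (x e.2))) s =
      aligned es (fun=> beta') s * aligned es (fun=> beta) (fun u => s u == x u).
    rewrite -big_split/=; apply: eq_bigr => e _.
    by rewrite !spin_mul -expRD; congr expR; ring.
  by ring.
rewrite [leRHS](_ : _ = spinsum l (fun s => spinsum l (fun x =>
   (1 - spin R (x v)) * (spin R (s v) *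
      aligned es (fun e => beta' + beta * (spin R (x e.1) * spin R (x e.2))) s))
      (fun=> true)) (fun=> true)); last first.
  apply/eqP; rewrite eq_le; apply/andP.
  by split; apply: le_spinsum => s sT; rewrite E.
rewrite spinsum_exchange; apply: spinsum_ge0 => x.
rewrite spinsumZ; apply: mulr_ge0; first by rewrite /spin; case: (x v); lra.
(* The couplings are at least beta' - beta, hence nonnegative. *)
apply: griffiths1 => e; rewrite /spin.
by case: (x e.1); case: (x e.2); lra.
Qed.

Lemma avg_spin_mono beta beta' es l v : 0 <= beta <= beta' ->
  avg beta es l (fun s => spin R (s v)) (fun=> true) <=
  avg beta' es l (fun s => spin R (s v)) (fun=> true).
Proof.
move=> bb'; have := ginibre es l v bb'.
rewrite (eq_spinsum _ _ (G := fun s =>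
  (spin R (s v) * boltz beta' es s) * spinsum l (boltz beta es) (fun=> true) -
  boltz beta' es s * spinsum l (fun t => spin R (t v) * boltz beta es t) (fun=> true))); last first.
  move=> s; rewrite -!spinsumZ -spinsumB; apply: eq_spinsum => t; ring.
rewrite spinsumB !spinsumZr subr_ge0 => h.
rewrite /avg ler_pdivrMr ?partition_gt0// mulrAC ler_pdivlMr ?partition_gt0//.
by rewrite mulrC.
Qed.

Lemma avg_spin_ge0 beta es l v : 0 <= beta ->
  0 <= avg beta es l (fun s => spin R (s v)) (fun=> true).
Proof.
move=> b0; apply: divr_ge0; last exact: ltW (partition_gt0 _ _ _ _).
rewrite (eq_spinsum _ _ (fun s => congr1 _ (boltz_prod beta es s))).
exact: griffiths1.
Qed.

(** Multiplying all spins by -1 preserves the energy and exchanges the two boundary conditions. *)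
Lemma avg_spin_flip beta es l v :
  avg beta es l (fun s => spin R (s v)) (fun=> false) =
  - avg beta es l (fun s => spin R (s v)) (fun=> true).
Proof.
have eE s : energy es (spinmul (fun=> false) s) = energy es s :> R.
  by apply: eq_bigr => e _; rewrite /spinmul !spin_mul /spin; ring.
have bE s : boltz beta es (spinmul (fun=> false) s) = boltz beta es s by rewrite /boltz eE.
rewrite /avg !(spinsum_mul _ _ (fun=> false) (fun=> false)) -mulNr.
congr (_ / _); last exact: eq_spinsum.
rewrite -mulN1r -spinsumZ; apply: eq_spinsum => s.
by rewrite bE /spinmul spin_mul /spin mulrA.
Qed.

End griffiths.

(** * Ising models on layered graphs *)

Section consistency.
Context {R : realType} {S : eqType}.
Implicit Types (l : seq S) (es : seq (S * S)) (F : (S -> bool) -> R).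

Definition free_of l (X : Type) (F : (S -> bool) -> X) :=
  forall s t, (forall v, v \notin l -> s v = t v) -> F s = F t.

(** Since [es1] does not see the spins of [l2], the average over both lists is an average, over the
    spins of [l1], of conditional averages over [l2]. *)
Lemma avg_cat_le beta es1 es2 l1 l2 F s c :
  free_of l2 (boltz beta es1 : _ -> R) ->
  (forall t, avg beta es2 l2 F t <= c) ->
  avg beta (es1 ++ es2) (l1 ++ l2) F s <= c.
Proof.
move=> free Fc; rewrite /avg !spinsum_cat ler_pdivrMr; last first.
  by apply: spinsum_gt0 => t; exact: partition_gt0.
rewrite -spinsumZ; apply: le_spinsum => t _.
rewrite (eq_spinsum _ _ (G := fun s => boltz beta es1 s * (F s * boltz beta es2 s))); last first.
  by move=> u; rewrite boltz_cat; ring.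
rewrite (eq_spinsum _ _ (F := boltz beta (es1 ++ es2))
  (G := fun s => boltz beta es1 s * boltz beta es2 s)); last first.
  by move=> u; rewrite boltz_cat.
have E G : spinsum l2 (fun s => boltz beta es1 s * G s) t = boltz beta es1 t * spinsum l2 G t.
  exact: spinsum_mull.
rewrite !E mulrCA ler_pM2l ?boltz_gt0//.
by have := Fc t; rewrite /avg ler_pdivrMr ?partition_gt0.
Qed.

Lemma avg_cat_ge beta es1 es2 l1 l2 F s c :
  free_of l2 (boltz beta es1 : _ -> R) ->
  (forall t, c <= avg beta es2 l2 F t) ->
  c <= avg beta (es1 ++ es2) (l1 ++ l2) F s.
Proof.
move=> free Fc; rewrite -lerN2 -mulN1r -avgZ; apply: avg_cat_le => // t.
by rewrite avgZ mulN1r lerN2.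
Qed.

End consistency.

(** * Functions of finitely many spins *)

Section local_functions.
Context {R : realType} {S : eqType}.
Implicit Types (D : seq S) (F : (S -> bool) -> R).

Definition allup (A : seq S) (s : S -> bool) : R := (all s A)%:R.

Lemma allup_ge0 A s : 0 <= allup A s. Proof. exact: ler0n. Qed.

Lemma allup_le1 A s : allup A s <= 1.
Proof. by rewrite /allup; case: all. Qed.

Lemma allup_incr A : increasing (allup A).
Proof.
move=> s t st; rewrite /allup; have [/allP sA|_] := boolP (all s A); last exact: ler0n.
suff -> : all t A by [].
by apply/allP => v /sA sv; have := st v; rewrite sv.
Qed.

(** Turning up a spin of [A] raises the sum by at least 1 and the indicator by at most 1. This lets
    FKG bound the gap of [allup A] by the gaps of single spins. *)
Lemma allup_sum_incr A : increasing (fun s => \sum_(v <- A) allup [:: v] s - allup A s).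
Proof.
move=> s t st /=; elim: A => [|v A IH]; first by rewrite !big_nil lexx.
rewrite !big_cons /allup /= !andbT.
have := st v; have := IH; have := @allup_incr A s t st; rewrite /allup.
have g0 (u : S -> bool) : 0 <= (all u A)%:R :> R by exact: ler0n.
have g1 (u : S -> bool) : (all u A)%:R <= 1 :> R by case: all.
move: (g0 s) (g0 t) (g1 s) (g1 t).
by case: (s v); case: (t v) => //=; lra.
Qed.

(** The increasing indicators [allup A] span the functions of the spins in [D], so linear statements
    about local functions reduce to them. *)
Lemma local_ind (Q : ((S -> bool) -> R) -> Prop) D :
  (forall F G, Q F -> Q G -> Q (fun s => F s + G s)) ->
  (forall c F, Q F -> Q (fun s => c * F s)) ->
  (forall A, {subset A <= D} -> Q (allup A)) ->
  forall F, depends_on (mem D) F -> Q F.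
Proof.
move=> QD QZ QA F dF.
(* The set [A] collects the sites already expanded, and [G] depends only on the remaining ones. *)
suff H D' A : {subset D' <= D} -> {subset A <= D} -> forall G, depends_on (mem D') G ->
    Q (fun s => allup A s * G s).
  have := H D [::] (fun _ => id) (fun _ => ltac:(by [])) F dF.
  by congr Q; apply/funext => s; rewrite /allup mul1r.
elim: D' A => [|v D' IH] A sD' sA G dG.
  have := QZ (G (fun=> true)) _ (QA A sA); congr Q; apply/funext => s.
  by rewrite mulrC; congr (_ * _); apply: dG.
have dGc c : depends_on (mem D') (fun s => G (set_spin s v c)).
  move=> s t st; apply: dG => u; rewrite inE /set_spin => /orP[->//|uD'].
  by case: eqP => // _; apply: st.
have vD : v \in D by apply: sD'; rewrite mem_head.
have sD'D : {subset D' <= D} by move=> u uD'; apply: sD'; rewrite inE uD' orbT.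
have sA' : {subset v :: A <= D} by move=> u; rewrite inE => /orP[/eqP ->//|/sA].
(* With G+ and G- the values of [G] for the two spins at [v], G = G- + 1[v is +] (G+ - G-). *)
have := QD _ _ (IH A sD'D sA _ (dGc false))
  (QD _ _ (IH (v :: A) sD'D sA' _ (dGc true))
     (QZ (-1) _ (IH (v :: A) sD'D sA' _ (dGc false)))).
congr Q; apply/funext => s; rewrite /allup /=.
have -> : G s = if s v then G (set_spin s v true) else G (set_spin s v false).
  rewrite -fun_if; congr G; apply/funext => u.
  by case sv: (s v); rewrite /set_spin; case: eqP => // ->.
by case: (s v) => /=; ring.
Qed.

Lemma local_lower_bound D F : depends_on (mem D) F -> (forall s, 0 < F s) ->
  exists2 d, 0 < d & forall s, d <= F s.
Proof.
elim: D F => [|v D IH] F dF F0.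
  exists (F (fun=> true)) => // s; rewrite (dF _ s)// lexx.
have dFc c : depends_on (mem D) (fun s => F (set_spin s v c)).
  move=> s t st; apply: dF => u; rewrite inE /set_spin => /orP[->//|uD].
  by case: eqP => // _; apply: st.
have [d1 d10 d1F] := IH _ (dFc true) (fun=> F0 _).
have [d2 d20 d2F] := IH _ (dFc false) (fun=> F0 _).
exists (Num.min d1 d2); first by rewrite lt_min d10.
move=> s; have <- : set_spin s v (s v) = s.
  by apply/funext => u; rewrite /set_spin; case: eqP => // ->.
by rewrite ge_min; case: (s v); rewrite ?d1F ?d2F ?orbT.
Qed.

End local_functions.

(** * Plus and minus boundary conditions on a sequence of strips *)

Section layered.
Context {R : realType}.
Local Notation S := (nat * nat)%type.
Variable w : nat -> seq bool.
Implicit Types (D : seq S) (F : (S -> bool) -> R) (beta : R).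

Definition level_sites j : seq S := [seq (j, i) | i <- iota 0 (ups (w j))].

(* The width of the level j.+1 is written downs (w j): the edges of the strip j do not
   involve the strip j.+1. *)
Definition strip_edges j : seq (S * S) :=
  [seq ((j, i %% ups (w j))%N, (j, i.+1 %% ups (w j))%N) | i <- iota 0 (ups (w j))] ++
  [seq ((j, ups (take p (w j)) %% ups (w j))%N,
        (j.+1, downs (take p (w j)) %% downs (w j))%N) | p <- iota 0 (size (w j))].

(* The k levels from n on, topmost first: spinsum then sums over the lowest levels
   innermost. *)
Fixpoint sites n k : seq S :=
  if k is k'.+1 then level_sites (n + k') ++ sites n k' else [::].

Fixpoint edges n k : seq (S * S) :=
  if k is k'.+1 then strip_edges (n + k') ++ edges n k' else [::].

Lemma sitesD m n k : sites m (n + k) = sites (m + n) k ++ sites m n.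
Proof. by elim: k => [|k IH]; rewrite ?addn0// addnS /= IH catA addnA. Qed.

Lemma edgesD m n k : edges m (n + k) = edges (m + n) k ++ edges m n.
Proof. by elim: k => [|k IH]; rewrite ?addn0// addnS /= IH catA addnA. Qed.

Lemma mem_sites n k v : (v \in sites n k) = (n <= v.1 < n + k)%N && (v.2 < ups (w v.1))%N.
Proof.
case: v => a b /=; elim: k => [|k IH] /=.
  by rewrite addn0 in_nil; case: (leqP n a) => //= h; rewrite ltnNge h.
rewrite mem_cat IH; apply/orP/idP.
  move=> [/mapP[i]|]; last by move=> /andP[/andP[-> h] ->]; rewrite addnS (leqW h).
  rewrite mem_iota add0n => /andP[_ lti] [-> ->]; rewrite lti andbT addnS ltnS leqnn andbT.
  exact: leq_addr.
move=> /andP[/andP[na]]; rewrite addnS ltnS leq_eqVlt => /orP[/eqP ank|ank] bw.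
  left; apply/mapP; exists b; last by rewrite -ank.
  by rewrite mem_iota add0n -ank.
by right; rewrite na ank.
Qed.

Lemma strip_edges_level j e : e \in strip_edges j ->
  e.1.1 = j /\ (j <= e.2.1 <= j.+1)%N.
Proof. by rewrite mem_cat => /orP[] /mapP[i _ ->] /=; rewrite leqnn leqnSn. Qed.

Lemma edges_level n k e : e \in edges n k ->
  (n <= e.1.1 < n + k)%N /\ (e.1.1 <= e.2.1 <= e.1.1.+1)%N.
Proof.
elim: k => //= k IH; rewrite mem_cat => /orP[/strip_edges_level[-> ->]|/IH[/andP[-> h] ->]].
  by rewrite leq_addr addnS ltnSn.
by rewrite addnS (leqW h).
Qed.

Lemma dep_boltz (D : {pred S}) beta es :
  {in es, forall e, e.1 \in D /\ e.2 \in D} -> depends_on D (boltz beta es : _ -> R).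
Proof.
move=> esD s t st; rewrite /boltz /energy; congr (expR (_ * _)).
by apply: eq_big_seq => e /esD[e1 e2]; rewrite !st.
Qed.

Lemma edges_free m k n beta : (n <= m)%N ->
  free_of (sites 0 n) (boltz beta (edges m k) : _ -> R).
Proof.
move=> nm s t st; apply: (@dep_boltz [pred v | v \notin sites 0 n]) => //.
move=> [[a b] [c d]] /edges_level [/= /andP[ma _] /andP[ac _]].
by rewrite !inE !mem_sites /= !negb_and -!leqNgt (leq_trans nm ma) (leq_trans nm (leq_trans ma ac)).
Qed.

(** The levels 0 to N - 1 are summed and the level N carries the boundary condition, so this
    corresponds to the finite-volume measure of index N - 1. *)
Definition layer_avg beta N F (s : S -> bool) : R :=
  avg beta (edges 0 N) (sites 0 N) F s.

Definition plus : S -> bool := fun=> true.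
Definition minus : S -> bool := fun=> false.

Lemma spinle_plus s : spinle s plus.
Proof. by move=> v; rewrite implybT. Qed.

Lemma spinle_minus s : spinle minus s.
Proof. by []. Qed.

(** Given the spins of the level that is added, the conditional average is at most the one under +
    by FKG. *)
Lemma layer_avg_plus_noninc beta F : 0 <= beta -> (forall s, 0 <= F s) -> increasing F ->
  nonincreasing_seq (fun N => layer_avg beta N F plus).
Proof.
move=> b0 F0 iF; apply/nonincreasing_seqP => n.
rewrite /layer_avg -addn1 edgesD sitesD.
apply: avg_cat_le => [|t]; first exact: edges_free.
exact/avg_mono/spinle_plus.
Qed.

Lemma layer_avg_minus_nondec beta F : 0 <= beta -> (forall s, 0 <= F s) -> increasing F ->
  nondecreasing_seq (fun N => layer_avg beta N F minus).
Proof.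
move=> b0 F0 iF; apply/nondecreasing_seqP => n.
rewrite /layer_avg -addn1 edgesD sitesD.
apply: avg_cat_ge => [|t]; first exact: edges_free.
exact/avg_mono/spinle_minus.
Qed.

Lemma cvg_layer_avg_plus beta D F : 0 <= beta -> depends_on (mem D) F ->
  cvgn (fun N => layer_avg beta N F plus).
Proof.
move=> b0; apply: (@local_ind _ _ (fun F => cvgn (fun N => layer_avg beta N F plus))).
- by move=> G H cG cH; rewrite /layer_avg; under eq_fun do rewrite avgD; apply: is_cvgD.
- by move=> c G cG; rewrite /layer_avg; under eq_fun do rewrite avgZ;
    apply: is_cvgM => //; exact: is_cvg_cst.
- move=> A _; apply: nonincreasing_is_cvgn.
    exact/layer_avg_plus_noninc/allup_incr/allup_ge0.
  exists 0 => _ [N _ <-]; rewrite -(avg_cst beta (edges 0 N) (sites 0 N) 0 plus).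
  exact/le_avg/allup_ge0.
Qed.

Lemma cvg_layer_avg_minus beta D F : 0 <= beta -> depends_on (mem D) F ->
  cvgn (fun N => layer_avg beta N F minus).
Proof.
move=> b0; apply: (@local_ind _ _ (fun F => cvgn (fun N => layer_avg beta N F minus))).
- by move=> G H cG cH; rewrite /layer_avg; under eq_fun do rewrite avgD; apply: is_cvgD.
- by move=> c G cG; rewrite /layer_avg; under eq_fun do rewrite avgZ;
    apply: is_cvgM => //; exact: is_cvg_cst.
- move=> A _; apply: nondecreasing_is_cvgn.
    exact/layer_avg_minus_nondec/allup_incr/allup_ge0.
  exists 1 => _ [N _ <-]; rewrite -[leRHS](avg_cst beta (edges 0 N) (sites 0 N) 1 minus).
  exact/le_avg/allup_le1.
Qed.

Definition gap beta N F : R := layer_avg beta N F plus - layer_avg beta N F minus.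

(** Vanishing of the spontaneous magnetization: by [gap_spin] the quantity is the expectation of the
    spin at [v] under +. The bound on [v.2] selects the pairs that are vertices. *)
Definition no_magnetization beta := forall v, (v.2 < ups (w v.1))%N ->
  gap beta N (allup [:: v]) @[N --> \oo] --> 0.

Lemma gapD beta N F G : gap beta N (fun s => F s + G s) = gap beta N F + gap beta N G.
Proof. by rewrite /gap /layer_avg !avgD; ring. Qed.

Lemma gapZ beta N c F : gap beta N (fun s => c * F s) = c * gap beta N F.
Proof. by rewrite /gap /layer_avg !avgZ; ring. Qed.

Lemma gap_allup beta A N : 0 <= beta ->
  0 <= gap beta N (allup A) <= \sum_(v <- A) gap beta N (allup [:: v]).
Proof.
move=> b0; apply/andP; split.
  by rewrite subr_ge0; apply: avg_mono => //; do ?[exact: allup_ge0|exact: allup_incr].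
pose U s : R := \sum_(v <- A) allup [:: v] s.
(* The constant 1 makes this increasing function nonnegative, as [avg_mono] requires; it cancels in
   the gap. *)
pose F s : R := 1 + (U s - allup A s).
have : 0 <= gap beta N F.
  rewrite subr_ge0; apply: avg_mono => //; last first.
    by move=> s t st; rewrite lerD2l; exact: allup_sum_incr.
  move=> s; rewrite /F addrCA -[leLHS](addr0 0); apply: lerD.
    by apply: sumr_ge0 => v _; exact: allup_ge0.
  by rewrite subr_ge0 allup_le1.
have FE s : layer_avg beta N F s = 1 + (layer_avg beta N U s - layer_avg beta N (allup A) s).
  by rewrite -avgB -[X in X + _](avg_cst beta (edges 0 N) (sites 0 N) 1 s) -avgD.
have E s : layer_avg beta N U s = \sum_(v <- A) layer_avg beta N (allup [:: v]) s.
  transitivity (\sum_(v <- A) 1 * avg beta (edges 0 N) (sites 0 N) (allup [:: v]) s).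
    rewrite -avg_sum; congr avg; apply/funext => t.
    by apply: eq_bigr => v _; rewrite mul1r.
  by apply: eq_bigr => v _; rewrite mul1r.
rewrite /gap !FE !E sumrB; lra.
Qed.

Lemma gap_local beta D F : 0 <= beta -> no_magnetization beta ->
  {in D, forall v, v.2 < ups (w v.1)}%N -> depends_on (mem D) F ->
  gap beta N F @[N --> \oo] --> 0.
Proof.
move=> b0 noM DV.
apply: (@local_ind _ _ (fun F => gap beta N F @[N --> \oo] --> 0)).
- move=> G H cG cH.
  have h : (fun N => gap beta N G + gap beta N H) @ \oo --> (0 + 0 : R) by exact: cvgD.
  have E : (fun N => gap beta N G + gap beta N H) = (fun N => gap beta N (fun s => G s + H s)).
    by apply/funext => N; rewrite gapD.
  by rewrite addr0 E in h.
- move=> c G cG.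
  have h : (fun N => c * gap beta N G) @ \oo --> (c * 0 : R) by apply: cvgM => //; exact: cvg_cst.
  have E : (fun N => c * gap beta N G) = (fun N => gap beta N (fun s => c * G s)).
    by apply/funext => N; rewrite gapZ.
  by rewrite mulr0 E in h.
- move=> A AD; apply: (@squeeze_cvgr _ _ _ _ (fun=> 0)
      (fun N => \sum_(v <- A) gap beta N (allup [:: v]))).
  + by near=> N; exact: gap_allup.
  + exact: cvg_cst.
  + have {}AD : {in A, forall v, v.2 < ups (w v.1)}%N by move=> v /AD /DV.
    elim: A AD => [|v A IH] AD.
      by under eq_fun do rewrite big_nil; exact: cvg_cst.
    have h : (fun N => gap beta N (allup [:: v]) + \sum_(v <- A) gap beta N (allup [:: v]))
        @ \oo --> (0 + 0 : R).
      apply: cvgD; first by apply/noM/AD; rewrite mem_head.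
      by apply: IH => u uA; apply: AD; rewrite inE uA orbT.
    by rewrite addr0 in h; under eq_fun do rewrite big_cons.
Unshelve. all: by end_near. Qed.

(** A spin is twice its indicator minus 1, and its averages under + and - are opposite. *)
Lemma gap_spin beta N v : gap beta N (allup [:: v]) =
  layer_avg beta N (fun s => spin R (s v)) plus.
Proof.
have E s : layer_avg beta N (fun t => spin R (t v)) s =
    2 * layer_avg beta N (allup [:: v]) s - 1.
  rewrite /layer_avg -avgZ -[X in _ - X](avg_cst beta (edges 0 N) (sites 0 N) 1 s) -avgB.
  congr avg; apply/funext => t; rewrite /allup /= andbT /spin.
  by case: (t v) => /=; lra.
have := avg_spin_flip beta (edges 0 N) (sites 0 N) v.
rewrite -!/(layer_avg _ _ _ _) -/minus -/plus !E /gap; lra.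
Qed.

Lemma no_magnetization_mono beta beta' : 0 <= beta <= beta' ->
  no_magnetization beta' -> no_magnetization beta.
Proof.
move=> bb' noM v /noM vM; apply: (squeeze_cvgr _ _ vM); last exact: cvg_cst.
near=> N; rewrite !gap_spin avg_spin_mono// andbT.
by apply: avg_spin_ge0; case/andP: bb'.
Unshelve. all: by end_near. Qed.

(** At beta = 0 all weights are 1, so the boundary condition has no effect once the level of [v] is
    summed over. *)
Lemma no_magnetization0 : no_magnetization 0.
Proof.
move=> v vw; apply: cvg_near_cst; exists v.1.+1 => // N /= vN.
apply/eqP; rewrite subr_eq0 /layer_avg /avg; apply/eqP.
have b1 s : boltz 0 (edges 0 N) s = 1 :> R by rewrite /boltz mul0r expR0.
have dpd F : depends_on (mem [:: v]) F -> spinsum (sites 0 N) F plus = spinsum (sites 0 N) F minus.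
  move=> dF; apply: (dep_spinsum dF) => u.
  by rewrite !inE => /andP[/eqP -> ]; rewrite mem_sites add0n vN vw.
congr (_ / _); apply: dpd; last by move=> s t _; rewrite !b1.
by move=> s t st; rewrite !b1 /allup /= st// mem_head.
Qed.

End layered.

(** * Change of finitely many strips *)

Section tail_invariance.
Context {R : realType}.
Local Notation S := (nat * nat)%type.
Implicit Types (w : nat -> seq bool) (F : (S -> bool) -> R) (beta : R).

Definition matching w := forall j, (0 < ups (w j))%N /\ downs (w j) = ups (w j.+1).

Lemma edges_sites w n k e : matching w -> e \in edges w n k ->
  (e.1.2 < ups (w e.1.1))%N /\ (e.2.2 < ups (w e.2.1))%N.
Proof.
move=> wm; elim: k => //= k IH; rewrite !mem_cat -orbA => /or3P[||/IH//] /mapP[i _ ->] /=.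
  by rewrite !ltn_pmod//; have [] := wm (n + k)%N.
by have [? dE] := wm (n + k)%N; rewrite dE !ltn_pmod//; have [] := wm (n + k).+1.
Qed.

Lemma spinsum_layers w n k F beta s :
  spinsum (sites w 0 (n + k)) (fun t => F t * boltz beta (edges w 0 (n + k)) t) s =
  spinsum (sites w n k) (fun t => boltz beta (edges w n k) t *
     spinsum (sites w 0 n) (fun u => F u * boltz beta (edges w 0 n) u) t) s.
Proof.
rewrite sitesD edgesD spinsum_cat add0n; apply: eq_spinsum => t.
rewrite -spinsum_mull; last exact: edges_free.
by apply: eq_spinsum => u; rewrite boltz_cat mulrCA.
Qed.

(** The unnormalized expectation over the levels below n; for F = 1, their partition function with
    the spins above as boundary condition. *)
Definition bottom_sum w n F beta (t : S -> bool) : R :=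
  spinsum (sites w 0 n) (fun u => F u * boltz beta (edges w 0 n) u) t.

Lemma bottom_sum1_gt0 w n beta t : 0 < bottom_sum w n (fun=> 1) beta t.
Proof. by apply: spinsum_gt0 => u; rewrite mul1r boltz_gt0. Qed.

Lemma dep_bottom_sum w n F beta D : matching w -> depends_on (mem D) F ->
  depends_on (mem [seq v <- D ++ sites w 0 n.+1 | v \notin sites w 0 n]) (bottom_sum w n F beta).
Proof.
move=> wm dF; have dFW : depends_on (mem (D ++ sites w 0 n.+1))
    (fun u => F u * boltz beta (edges w 0 n) u).
  move=> s t st; congr (_ * _).
    by apply: dF => v vD; apply: st; rewrite mem_cat vD.
  apply: dep_boltz st => -[[a b] [c d]] eE.
  have [/= e1 e2] := edges_sites wm eE.
  have [/andP[_ an] /andP[_ ca]] := edges_level eE; rewrite add0n /= in an ca.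
  have sD u : (u.1 <= n)%N -> (u.2 < ups (w u.1))%N -> u \in D ++ sites w 0 n.+1.
    by move=> u1 u2; rewrite mem_cat mem_sites add0n leq0n ltnS u1 u2 orbT.
  by split; apply: sD => //=; [exact: ltnW|exact: leq_trans an].
move=> s t st; apply: (dep_spinsum dFW) => v; rewrite !inE => /andP[vD vn].
by apply: st; rewrite mem_filter vn.
Qed.

(* The two graphs have the same top part, so passing from one to the other reweights by the
   ratio of the partition functions of the bottom parts, seen as functions of the spins
   above. *)
Lemma layer_avg_bottom w w' n k F beta s :
  (forall j, (n <= j)%N -> w' j = w j) ->
  free_of (sites w 0 n) (bottom_sum w' n F beta) ->
  free_of (sites w 0 n) (bottom_sum w' n (fun=> 1) beta) ->
  free_of (sites w 0 n) (bottom_sum w n (fun=> 1) beta) ->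
  layer_avg w' beta (n + k) F s =
  layer_avg w beta (n + k)
    (fun t => bottom_sum w' n F beta t / bottom_sum w n (fun=> 1) beta t) s /
  layer_avg w beta (n + k)
    (fun t => bottom_sum w' n (fun=> 1) beta t / bottom_sum w n (fun=> 1) beta t) s.
Proof.
move=> ww' fF f1 fw.
have sE : sites w' n k = sites w n k.
  by elim: (k) => //= m ->; rewrite /level_sites ww'// leq_addr.
have eE : edges w' n k = edges w n k.
  by elim: (k) => //= m ->; rewrite /strip_edges ww'// leq_addr.
pose T G := spinsum (sites w n k) (fun t => boltz beta (edges w n k) t * G t) s.
have E1 G : spinsum (sites w' 0 (n + k)) (fun t => G t * boltz beta (edges w' 0 (n + k)) t) s =
    T (bottom_sum w' n G beta).
  by rewrite spinsum_layers sE eE.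
have E2 G : free_of (sites w 0 n) G -> spinsum (sites w 0 (n + k))
    (fun t => G t / bottom_sum w n (fun=> 1) beta t * boltz beta (edges w 0 (n + k)) t) s = T G.
  move=> fG; rewrite spinsum_layers; apply: eq_spinsum => t; congr (_ * _).
  rewrite (spinsum_mull (F := fun t => G t / bottom_sum w n (fun=> 1) beta t)); last first.
    by move=> u u' uu'; rewrite (fG _ _ uu') (fw _ _ uu').
  have -> : spinsum (sites w 0 n) (boltz beta (edges w 0 n)) t = bottom_sum w n (fun=> 1) beta t.
    by apply: eq_spinsum => u; rewrite mul1r.
  by rewrite divfK// gt_eqF// bottom_sum1_gt0.
have Z0 w1 : spinsum (sites w1 0 (n + k)) (boltz beta (edges w1 0 (n + k))) s != 0.
  by rewrite gt_eqF// partition_gt0.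
have E3 : spinsum (sites w' 0 (n + k)) (boltz beta (edges w' 0 (n + k))) s =
    T (bottom_sum w' n (fun=> 1) beta).
  by rewrite -E1; apply: eq_spinsum => u; rewrite mul1r.
rewrite /layer_avg /avg E1 E3 !E2//.
have := Z0 w'; rewrite E3 => T0.
by have := Z0 w => Zw; field; rewrite T0 Zw.
Qed.

(** By [layer_avg_bottom] an average for [w'] is a quotient of averages of two local functions for
    [w]. The limits of these under + and - coincide by [gap_local], so the two quotients have the
    same limit. *)
Lemma no_magnetization_tail w w' n beta : 0 <= beta -> matching w -> matching w' ->
  (forall j, (n <= j)%N -> w' j = w j) ->
  no_magnetization w beta -> no_magnetization w' beta.
Proof.
move=> b0 wm wm' ww' noM v vw'.
pose f : (S -> bool) -> R := allup [:: v].
have df : depends_on (mem [:: v]) f.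
  by move=> s t st; rewrite /f /allup /= st ?mem_head.
have d1 : depends_on (mem ([::] : seq S)) (fun=> 1 : R) by [].
pose Z := bottom_sum w n (fun=> 1) beta.
pose Z' := bottom_sum w' n (fun=> 1) beta.
pose A' := bottom_sum w' n f beta.
(* The sites read by the three bottom sums. They lie at levels at least n, where the two graphs
   agree. *)
pose D := [seq u <- ([:: v] ++ sites w' 0 n.+1) | u \notin sites w' 0 n] ++
  [seq u <- sites w' 0 n.+1 | u \notin sites w' 0 n] ++
  [seq u <- sites w 0 n.+1 | u \notin sites w 0 n].
have DP u : u \in D -> (n <= u.1)%N /\ (u.2 < ups (w u.1))%N.
  have aux w1 : u \in [seq u <- sites w1 0 n.+1 | u \notin sites w1 0 n] ->
      (n <= u.1)%N /\ (u.2 < ups (w1 u.1))%N.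
    rewrite mem_filter !mem_sites => /andP[h /andP[_ h2]].
    by move: h; rewrite h2 andbT /= add0n -leqNgt.
  have aux' : (n <= u.1)%N /\ (u.2 < ups (w' u.1))%N -> (n <= u.1)%N /\ (u.2 < ups (w u.1))%N.
    by move=> [nu]; rewrite ww'.
  rewrite /D filter_cat !mem_cat => /orP[/orP[|]|/orP[|]].
  - rewrite mem_filter mem_seq1 => /andP[h /eqP uv]; apply: aux'; split; last by rewrite uv.
    by move: h; rewrite mem_sites uv vw' andbT /= add0n -leqNgt.
  - by move=> /aux /aux'.
  - by move=> /aux /aux'.
  - by move=> /aux.
have dA : depends_on (mem D) A'.
  apply: dep_sub (dep_bottom_sum (n := n) beta wm' df) => u.
  by rewrite /D mem_cat => ->.
have dZ' : depends_on (mem D) Z'.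
  apply: dep_sub (dep_bottom_sum (n := n) beta wm' d1) => u.
  by rewrite /D !mem_cat => ->; rewrite orbT.
have dZ : depends_on (mem D) Z.
  apply: dep_sub (dep_bottom_sum (n := n) beta wm d1) => u.
  by rewrite /D !mem_cat => ->; rewrite !orbT.
have Dfree F : depends_on (mem D) F -> free_of (sites w 0 n) F.
  move=> dF s t st; apply: dF => u /DP[nu _]; apply: st.
  by rewrite mem_sites add0n [in X in ~~ (X && _)]ltnNge nu.
pose h' t := A' t / Z t; pose h t := Z' t / Z t.
have dh' : depends_on (mem D) h' by move=> s t st; rewrite /h' (dA _ _ st) (dZ _ _ st).
have dh : depends_on (mem D) h by move=> s t st; rewrite /h (dZ' _ _ st) (dZ _ _ st).
(* This bound keeps the limit of the denominators away from 0. *)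
have [d d0 dh0] : exists2 d, 0 < d & forall s, d <= h s.
  by apply: local_lower_bound dh _ => s; rewrite divr_gt0// bottom_sum1_gt0.
have DV : {in D, forall u, u.2 < ups (w u.1)}%N by move=> u /DP[].
have gh' := gap_local b0 noM DV dh'.
have gh := gap_local b0 noM DV dh.
have ratio k s : layer_avg w' beta (n + k) f s =
    layer_avg w beta (n + k) h' s / layer_avg w beta (n + k) h s.
  by apply: layer_avg_bottom => //; exact: Dfree.
have cm F : depends_on (mem D) F -> gap w beta N F @[N --> \oo] --> 0 ->
    layer_avg w beta N F minus @[N --> \oo] -->
    limn (fun N => layer_avg w beta N F plus).
  move=> dF gF.
  have h1 : (fun N => layer_avg w beta N F plus - gap w beta N F) @ \oo -->
      (limn (fun N => layer_avg w beta N F plus) - 0 : R).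
    by apply: cvgB => //; exact: cvg_layer_avg_plus dF.
  have E : (fun N => layer_avg w beta N F plus - gap w beta N F) =
      (fun N => layer_avg w beta N F minus).
    by apply/funext => N; rewrite /gap; ring.
  by rewrite subr0 E in h1.
have L0 : limn (fun N => layer_avg w beta N h plus) != 0.
  rewrite gt_eqF// (lt_le_trans d0)//; apply: limr_ge; first exact: cvg_layer_avg_plus dh.
  near=> N; rewrite -(avg_cst beta (edges w 0 N) (sites w 0 N) d plus).
  exact: le_avg.
have gr : (fun N => layer_avg w beta N h' plus / layer_avg w beta N h plus -
    layer_avg w beta N h' minus / layer_avg w beta N h minus) @ \oo -->
    (limn (fun N => layer_avg w beta N h' plus) / limn (fun N => layer_avg w beta N h plus) -
    limn (fun N => layer_avg w beta N h' plus) / limn (fun N => layer_avg w beta N h plus) : R).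
  apply: cvgB; apply: cvgM; try apply: cvgV => //.
  - exact: cvg_layer_avg_plus dh'.
  - exact: cvg_layer_avg_plus dh.
  - exact: cm.
  - exact: cm.
rewrite subrr in gr.
(* The quotient formula concerns volumes of height at least n. *)
rewrite -(cvg_shiftn n) in gr; rewrite -(cvg_shiftn n).
rewrite [X in X @ \oo --> _](_ : _ = (fun k => layer_avg w beta (k + n) h' plus /
    layer_avg w beta (k + n) h plus - layer_avg w beta (k + n) h' minus /
    layer_avg w beta (k + n) h minus))//.
by apply/funext => k /=; rewrite /gap addnC !ratio.
Unshelve. all: by end_near. Qed.

Lemma eq_layer_avg w w' N beta F s :
  (forall j, (j < N)%N -> w' j = w j) -> layer_avg w' beta N F s = layer_avg w beta N F s.
Proof.
move=> ww'; have [sE eE] : sites w' 0 N = sites w 0 N /\ edges w' 0 N = edges w 0 N.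
  elim: N ww' => //= N IH ww'; have [|-> ->] := IH.
    by move=> j jN; rewrite ww'// ltnW.
  by rewrite /level_sites /strip_edges !add0n ww'.
by rewrite /layer_avg sE eE.
Qed.

End tail_invariance.

(** * The finite-volume measures of the statement *)

Section finite_volume.
Context {R : realType}.

(** Finiteness is proved along with the equality because splitting the sum over the first spin needs
    it. *)
Lemma fsbig_spinsum (S : eqType) (l : seq S) (F : (S -> bool) -> R) (b : S -> bool) :
  uniq l ->
  finite_set [set s : S -> bool | forall v, v \notin l -> s v = b v] /\
  \sum_(s \in [set s | forall v, v \notin l -> s v = b v]) F s = spinsum l F b.
Proof.
elim: l b => [|v l IH] b /=.
  have -> : [set s : S -> bool | forall v, v \notin [::] -> s v = b v] = [set b].
    by apply/seteqP; split=> s /= sb; [apply/funext => v; exact: sb|rewrite sb].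
  by rewrite fsbig_set1; split => //; exact: finite_set1.
move=> /andP[vl ul].
have -> : [set s : S -> bool | forall u, u \notin v :: l -> s u = b u] =
    [set s | forall u, u \notin l -> s u = set_spin b v true u] `|`
    [set s | forall u, u \notin l -> s u = set_spin b v false u].
  apply/seteqP; split=> s /=.
    move=> sb; have H u : u \notin l -> s u = set_spin b v (s v) u.
      move=> unl; rewrite /set_spin; case: eqP => [->//|/eqP uv].
      by apply: sb; rewrite inE negb_or uv.
    by case: (s v) H => H; [left|right].
  move=> sb u; rewrite inE negb_or => /andP[/negbTE uv unl].
  by case: sb => /(_ _ unl) ->; rewrite /set_spin uv.
have [ft <-] := IH (set_spin b v true) ul; have [ff <-] := IH (set_spin b v false) ul.
split; first by rewrite finite_setU.
rewrite fsbigU//= => s [/(_ _ vl) + /(_ _ vl)].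
by rewrite /set_spin eqxx => ->.
Qed.

Variable T : LT.
Implicit Types (beta : R) (N : nat) (f : config T -> R).

(** All triangulations share the pairs of naturals as sites, so that configurations survive a change
    of triangulation. *)
Definition site (v : V T) : nat * nat := (tag v, val (tagged v)).

Lemma site_inj : injective site.
Proof.
move=> [j i] [j' i'] [/= jj]; case: _ / jj i' => i' ii'.
by congr existT; apply: val_inj.
Qed.

Lemma site_vert j k : site (vert T j k) = (j, k %% width T j)%N.
Proof. by []. Qed.

Lemma vert_site v : vert T (site v).1 (site v).2 = v.
Proof. by apply: site_inj; case: v => j i; rewrite site_vert /= modn_small. Qed.

Lemma width_site v : ((site v).2 < ups (T (site v).1))%N.
Proof. by case: v => j i /=. Qed.

Lemma site_vert_small p : (p.2 < ups (T p.1))%N -> site (vert T p.1 p.2) = p.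
Proof. by case: p => j i ij; rewrite site_vert modn_small. Qed.

Lemma matching_LT : matching T.
Proof. by move=> j; split; [exact: width_gt0|exact: downs_width]. Qed.

Lemma uniq_sites w n k : uniq (sites w n k).
Proof.
elim: k => //= k IH; rewrite cat_uniq IH andbT map_inj_uniq ?iota_uniq; last by move=> i i' [].
apply/hasPn => v; rewrite mem_sites => /andP[/andP[_ vk] _].
by apply/mapP => -[i _ vE]; rewrite vE ltnn in vk.
Qed.

Lemma ising_volumeE N (s : nat * nat -> bool) (F : config T -> R) :
  \sum_(t \in volume N (s \o site)) F t =
  spinsum (sites T 0 N.+1) (fun t => F (t \o site)) s.
Proof.
pose l : seq (V T) := [seq vert T p.1 p.2 | p <- sites T 0 N.+1].
have lE : map site l = sites T 0 N.+1.
  rewrite -map_comp -[RHS]map_id; apply/eq_in_map => p.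
  by rewrite mem_sites => /andP[_ ?] /=; rewrite site_vert_small.
rewrite -lE (spinsum_map _ _ _ site_inj).
have [|_ <-] := @fsbig_spinsum _ l F (s \o site).
  by rewrite -(map_inj_uniq site_inj) lE uniq_sites.
congr (\sum_(t \in _) _); apply/seteqP; split => t /= ts v vN; apply: ts.
  by rewrite -(mem_map site_inj) lE mem_sites width_site andbT -leqNgt in vN.
by rewrite -(mem_map site_inj) lE mem_sites width_site andbT -leqNgt.
Qed.

Fixpoint graph_edges k : seq (E T) :=
  if k is k'.+1 then
    [seq inl (Tagged (fun j => 'I_(width T j)) i) | i <- enum 'I_(width T k')] ++
    [seq inr (Tagged (fun j => 'I_(size (T j))) p) | p <- enum 'I_(size (T k'))] ++
    graph_edges k'
  else [::].

Lemma mem_graph_edges k e : (e \in graph_edges k) = (level (ends e).1 < k)%N.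
Proof.
elim: k => //= k IH; rewrite !mem_cat IH [RHS]ltnS [RHS]leq_eqVlt orbA; congr (_ || _).
apply/orP/eqP.
  by move=> [] /mapP[i _ ->].
case: e {IH} => -[j i] /= jk; [left|right]; apply/mapP; move: i; rewrite -?jk /level /= => i.
  by exists i => //; rewrite mem_enum.
by exists i => //; rewrite mem_enum.
Qed.

Lemma uniq_graph_edges k : uniq (graph_edges k).
Proof.
elim: k => //= k IH; rewrite !cat_uniq IH andbT.
have Ul : uniq [seq (inl (Tagged (fun j => 'I_(width T j)) i) : E T) | i <- enum 'I_(width T k)].
  by rewrite map_inj_uniq ?enum_uniq// => i i' [] /eqP; rewrite eq_Tagged => /eqP.
have Ur : uniq [seq (inr (Tagged (fun j => 'I_(size (T j))) p) : E T) | p <- enum 'I_(size (T k))].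
  by rewrite map_inj_uniq ?enum_uniq// => i i' [] /eqP; rewrite eq_Tagged => /eqP.
rewrite Ul Ur /=; apply/andP; split; apply/hasPn => e /=; rewrite ?mem_cat.
  move=> /orP[/mapP[i _ ->]|]; first by apply/mapP => -[].
  by rewrite mem_graph_edges => ek; apply/mapP => -[i _ eE]; rewrite eE /level /= ltnn in ek.
by rewrite mem_graph_edges => ek; apply/mapP => -[i _ eE]; rewrite eE /level /= ltnn in ek.
Qed.

Lemma sum_graph_edges k (s : nat * nat -> bool) :
  \sum_(e <- graph_edges k)
    spin R (s (site (ends e).1)) * spin R (s (site (ends e).2)) =
  energy (edges T 0 k) s.
Proof.
elim: k => [|k IH]; first by rewrite /energy !big_nil.
rewrite /energy /= !big_cat/= IH -/(energy _ _) addrA; congr (_ + _).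
have iE n : iota 0 n = index_iota 0 n by rewrite /index_iota subn0.
rewrite /energy !big_map add0n -!enumT !big_enum/= !iE !big_mkord; congr (_ + _).
by apply: eq_bigr => p _ /=; rewrite downs_width.
Qed.

(** Above the level N the configuration coincides with the boundary condition, so outer edges
    contribute like inner ones. Together they are the edges whose lower end is at level at most
    N. *)
Lemma hamiltonianE N (s b : nat * nat -> bool) : volume N (b \o site) (s \o site) ->
  hamiltonian R N (s \o site) (b \o site) = - energy (edges T 0 N.+1) s.
Proof.
move=> sb; rewrite -sum_graph_edges /hamiltonian -opprD; congr (- _).
have -> : \sum_(e \in outer_edges N) spin R ((s \o site) (ends e).1) *
      spin R ((b \o site) (ends e).2) =
    \sum_(e \in outer_edges N) spin R (s (site (ends e).1)) * spin R (s (site (ends e).2)).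
  apply: eq_fsbigr => e /set_mem[_ e2]; rewrite -[s (site _.2)]/((s \o site) _).
  by rewrite (sb (ends e).2)// e2.
have [uG memG] : uniq (graph_edges N.+1) /\
    forall e, (e \in graph_edges N.+1) = (level (ends e).1 <= N)%N.
  by split=> [|e]; [exact: uniq_graph_edges|rewrite mem_graph_edges].
move: (graph_edges _) uG memG => G uG memG.
have E : [set` G] = @inner_edges T N `|` @outer_edges T N.
  apply/seteqP; split => e /=; rewrite memG.
    move=> e1; have : (level (ends e).2 <= N.+1)%N.
      by case: e e1 => -[j i] /=; rewrite /level //= => /leqW.
    by rewrite leq_eqVlt ltnS => /orP[/eqP|] e2; [right|left].
  by move=> -[[]|[]].
have fE : finite_set (@inner_edges T N `|` @outer_edges T N).
  by rewrite -E; exact: finite_seq.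
rewrite -fsbigU0/=.
- by rewrite -E -fsbig_seq.
- by apply: sub_finite_set fE => e; left.
- by apply: sub_finite_set fE => e; right.
- by move=> e [[_ e2] [_ e2']]; rewrite e2' ltnn in e2.
Qed.

Lemma ising_expectationE beta N f (s : nat * nat -> bool) :
  ising_expectation beta N (s \o site) f =
  layer_avg T beta N.+1 (fun t => f (t \o site)) s.
Proof.
rewrite /ising_expectation !ising_volumeE /layer_avg /avg.
have wE t : (forall u, u \notin sites T 0 N.+1 -> t u = s u) ->
    ising_weight beta N (s \o site) (t \o site) = boltz beta (edges T 0 N.+1) t.
  move=> ts; rewrite /ising_weight hamiltonianE ?mulrNN// => v vN /=.
  by apply: ts; rewrite mem_sites width_site andbT -leqNgt.
congr (_ / _); apply/eqP; rewrite eq_le; apply/andP;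
  by split; apply: le_spinsum => t ts; rewrite wE.
Qed.

Definition extend (b : config T) (p : nat * nat) : bool := b (vert T p.1 p.2).

Lemma extendK b : extend b \o site = b.
Proof. by apply/funext => v; rewrite /extend /= vert_site. Qed.

End finite_volume.

(** * Infinite-volume limits *)

Section binary_splitting.
Context {R : realType}.
Variable p : seq bool -> R.
Hypotheses (p_ge0 : forall w, 0 <= p w) (p_nil : p [::] = 1)
  (p_cons : forall w, p w = p (true :: w) + p (false :: w)).

(* Words list the bits most recent first; those of length n cut [0, 1[ into consecutive
   intervals, the one of w having length p w. *)
Fixpoint left_end (w : seq bool) : R :=
  if w is c :: w' then left_end w' + (if c then p (false :: w') else 0) else 0.

Fixpoint bits (x : R) n : seq bool :=
  if n is n'.+1 then
    (left_end (bits x n') + p (false :: bits x n') <= x) :: bits x n'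
  else [::].

Definition bit x n := head false (bits x n.+1).

Lemma size_bits x n : size (bits x n) = n.
Proof. by elim: n => //= n ->. Qed.

(** Each further bit tells in which of the two consecutive pieces of the current interval [x] lies,
    the piece of false being on the left. *)
Lemma bitsP x w : 0 <= x < 1 ->
  (bits x (size w) == w) = (left_end w <= x < left_end w + p w).
Proof.
move=> x01; elim: w => [|c w IH] /=; first by rewrite p_nil add0r x01.
rewrite eqseq_cons.
have := p_cons w; have := p_ge0 (true :: w); have := p_ge0 (false :: w) => f0 t0 pw.
have [wE|wN] := eqVneq (bits x (size w)) w.
  rewrite wE andbT; move: IH; rewrite wE eqxx => /esym/andP[ax xb].
  case: c; last by rewrite addr0 ax /= eqbF_neg -ltNge.
  by rewrite eqb_id (_ : x < _ + _ + _) ?andbT//; lra.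
rewrite andbF; apply/esym/negbTE; apply: contraNN wN; rewrite IH.
by case: c; rewrite ?addr0 => /andP[? ?]; apply/andP; split; lra.
Qed.

Lemma left_end_bounds w : 0 <= left_end w /\ left_end w + p w <= 1.
Proof.
elim: w => [|c w [IH1 IH2]] /=; first by rewrite p_nil add0r.
have := p_cons w; have := p_ge0 (true :: w); have := p_ge0 (false :: w).
by case: c; rewrite ?addr0 => ? ? pw; split; lra.
Qed.

Lemma measurable_bits w : measurable [set x : R | bits x (size w) = w].
Proof.
elim: w => [|c w IH] /=.
  by rewrite (_ : [set _ | _] = setT)//; apply/seteqP.
have -> : [set x | (left_end (bits x (size w)) + p (false :: bits x (size w)) <= x) ::
      bits x (size w) = c :: w] =
    [set x | bits x (size w) = w] `&` [set x | (left_end w + p (false :: w) <= x) = c].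
  apply/seteqP; split => x /=; first by move=> [h h']; rewrite h' in h.
  by move=> [-> ->].
apply: measurableI => //; have mI : measurable [set x | left_end w + p (false :: w) <= x].
  rewrite (_ : [set _ | _] = [set` `[left_end w + p (false :: w), +oo[ ]).
    exact: measurable_itv.
  by apply/seteqP; split => x /=; rewrite in_itv /= andbT.
case: c => //; rewrite (_ : [set _ | _] = ~` [set x | left_end w + p (false :: w) <= x]).
  exact: measurableC.
by apply/seteqP; split => x /=; [move=> -> | move/negP/negbTE].
Qed.

Lemma lebesgue_bits w :
  lebesgue_measure ([set x : R | bits x (size w) = w] `&` `[0, 1[) = (p w)%:E.
Proof.
have -> : [set x : R | bits x (size w) = w] `&` `[0, 1[ =
    [set` `[left_end w, (left_end w + p w)[ ].
  have [l0 l1] := left_end_bounds w.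
  apply/seteqP; split => x /=; rewrite !in_itv /=.
    by move=> [xw x01]; rewrite -bitsP// xw.
  move=> xw; have x01 : 0 <= x < 1 by move: xw => /andP[? ?]; apply/andP; split; lra.
  by split=> //; apply/eqP; rewrite bitsP.
rewrite lebesgue_measure_itv /= lte_fin ltrDl; case: ltP => [_|pw].
  by rewrite -EFinB addrAC subrr add0r.
by congr EFin; apply/eqP; rewrite eq_le p_ge0 pw.
Qed.

Lemma measurable_bit n : measurable [set x : R | bit x n].
Proof.
have -> : [set x : R | bit x n] =
    \bigcup_(w in [set w | size w = n]) [set x | bits x (size (true :: w)) = true :: w].
  apply/seteqP; split => x /=; rewrite /bit /=.
    move=> xn; exists (bits x n); rewrite /= ?size_bits//.
    by congr cons.
  by move=> [w <- []] /= ->.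
have := @countable_bigcupT_measurable _ (measurableTypeR R) (seq bool)
  (fun w => if size w == n then [set x | bits x (size (true :: w)) = true :: w] else set0).
rewrite (_ : \bigcup_w (if _ then _ else set0) =
  \bigcup_(w in [set w | size w = n]) [set x | bits x (size (true :: w)) = true :: w]).
  apply; first exact: countableP.
  by move=> w; case: ifP => _; [exact: (measurable_bits (true :: w))|exact: measurable0].
apply/seteqP; split => x [w].
  by move=> _; case: ifP => // /eqP wn xw; exists w.
by move=> wn xw; exists w => //; rewrite /= in wn; rewrite wn eqxx.
Qed.

End binary_splitting.

(** * Configurations read along an enumeration of the vertices *)

Section prefixes.
Variables (V : eqType) (e : nat -> V).

(** The latest spin comes first, as in [bits]. *)
Fixpoint prefix (s : V -> bool) n : seq bool :=
  if n is n'.+1 then s (e n') :: prefix s n' else [::].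

Lemma size_prefix s n : size (prefix s n) = n.
Proof. by elim: n => //= n ->. Qed.

Lemma eq_prefix s t n : prefix s n = prefix t n <-> forall i, (i < n)%N -> s (e i) = t (e i).
Proof.
elim: n => [|n IH] //=; split.
  by move=> [sn /IH st] i; rewrite ltnS leq_eqVlt => /orP[/eqP ->//|/st].
by move=> st; rewrite st// (IH.2 _)// => i /ltnW; apply: st.
Qed.

Definition prefix_local n {X : Type} (f : (V -> bool) -> X) :=
  forall s t, prefix s n = prefix t n -> f s = f t.

Context {R : realType}.

Definition cylinder w (s : V -> bool) : R := (prefix s (size w) == w)%:R.

Lemma cylinder_local w : prefix_local (size w) (cylinder w).
Proof. by move=> s t; rewrite /cylinder => ->. Qed.

Lemma cylinder_ind (Q : ((V -> bool) -> R) -> Prop) n f :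
  (forall f g, Q f -> Q g -> Q (fun s => f s + g s)) ->
  (forall c f, Q f -> Q (fun s => c * f s)) ->
  (forall w, Q (cylinder w)) -> prefix_local n f -> Q f.
Proof.
move=> QD QZ Qc fn.
pose s_ w : V -> bool := xget (fun=> false) [set s | prefix s n = w].
have E : f = fun s => \sum_(w : n.-tuple bool) f (s_ w) * cylinder w s.
  apply/funext => s; have sz : size (prefix s n) == n by rewrite size_prefix.
  rewrite (bigD1 (Tuple sz))//= big1 ?addr0 => [|w wN]; last first.
    rewrite /cylinder size_tuple; case: eqP => [wE|]; last by rewrite mulr0.
    by move/eqP: wN; case; apply: val_inj.
  rewrite /cylinder size_prefix eqxx mulr1; apply: fn.
  by rewrite /s_; case: xgetP => //= /(_ s).
rewrite E; elim: (index_enum _) => [|w r IH].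
  have := QZ 0 _ (Qc [::]); congr Q; apply/funext => s; by rewrite mul0r big_nil.
have := QD _ _ (QZ (f (s_ w)) _ (Qc w)) IH; congr Q; apply/funext => s.
by rewrite big_cons.
Qed.

Hypothesis e_surj : forall v, exists n, v = e n.

Lemma prefix_nbhs (s : {ptws V -> bool}) n : \forall t \near s, prefix t n = prefix s n.
Proof.
elim: n => [|n IH]; first by near=> t.
have h : \forall t \near s, (t : V -> bool) (e n) = s (e n).
  have h := @proj_continuous V (fun=> bool) (e n) s.
  have h2 : nbhs (s (e n) : bool) [set s (e n)] by exact: discrete_set1.
  exact: (h [set s (e n)] h2).
by near=> t; rewrite /= (near h t)// (near IH t).
Unshelve. all: by end_near. Qed.

Lemma prefix_cvg (t : nat -> {ptws V -> bool}) (s : {ptws V -> bool}) :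
  (forall n, prefix (t n) n = prefix s n) -> t @ \oo --> s.
Proof.
move=> ts; apply/cvg_sup => v; apply/cvg_image.
  by rewrite eqEsubset; split=> b // _; exists (fun=> b).
move=> A /= sA; exists [set u : V -> bool | A (u v)]; last first.
  by rewrite eqEsubset; split => [_ [u + <-]//|b Ab]; exists (fun=> b).
have [i vi] := e_surj v; exists i.+1 => // n /= ilen.
rewrite vi ((eq_prefix _ _ _).1 (ts n) i ilen) -vi.
exact: (@nbhs_singleton bool).
Qed.

(** Uniform continuity on a compact space. At each point some depth works: otherwise configurations
    agreeing with it on longer and longer prefixes would converge to it while their images stay
    away. Compactness makes the depth uniform. *)
Lemma continuous_prefix (f : {ptws V -> bool} -> R) eps : continuous f -> 0 < eps ->
  exists n, forall s t, prefix s n = prefix t n -> `|f s - f t| < eps.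
Proof.
move=> cf eps0.
have cT : compact [set: {ptws V -> bool}].
  have := @tychonoff V (fun=> bool) (fun=> setT) (fun=> bool_compact).
  by congr compact; apply/seteqP.
have /compact_near_coveringP/(_ nat \oo
  (fun n s => forall t, prefix s n = prefix t n -> `|f s - f t| < eps)) := cT.
move=> /(_ _) []; last by move=> n _ /(_ n (leqnn n)) h; exists n => s t; exact: h.
move=> s _.
have [m ms] : exists m, forall t, prefix t m = prefix s m -> `|f s - f t| < eps / 2.
  apply: contrapT => /forallNP nex.
  have /choice[t tP] : forall m, exists t, prefix t m = prefix s m /\ ~ `|f s - f t| < eps / 2.
    by move=> m; have /existsNP[t /not_implyP] := nex m; exists t.
  have ct : t @ \oo --> (s : {ptws V -> bool}) by apply: prefix_cvg => n; exact: (tP n).1.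
  have : f \o t @ \oo --> f s by apply: cvg_comp ct _; exact: cf.
  move=> /cvgrPdist_lt/(_ (eps / 2)) [|N _ /(_ N (leqnn N))]; first by rewrite divr_gt0.
  exact: (tP N).2.
exists ([set s' : {ptws V -> bool} | prefix s' m = prefix s m], [set n | (m <= n)%N]).
  by split; [exact: prefix_nbhs|exists m].
move=> [s' n] /= [s'm mn] t s't.
have tm : prefix t m = prefix s m.
  rewrite -s'm; apply/eq_prefix => i im; move/eq_prefix: s't => ->//.
  exact: leq_trans mn.
rewrite (le_lt_trans (ler_distD (f s) _ _))// (splitr eps) ltrD// ?ms//.
by rewrite distrC ms.
Qed.

End prefixes.

Section word_measure.
Context {R : realType}.
Variables (T : LT) (e : nat -> V T) (e' : V T -> nat).
Hypotheses (eK : cancel e e') (e'K : cancel e' e).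

Let m01 : measurable (`[0%R, 1%R[ : set R). Proof. exact: measurable_itv. Qed.

Lemma lebesgue01 : mrestr (@lebesgue_measure R) m01 setT = 1%E.
Proof. by rewrite /mrestr setTI lebesgue_measure_itv /= lte01 oppr0 adde0. Qed.

HB.instance Definition _ := Measure_isProbability.Build _ _ _
  (mrestr (@lebesgue_measure R) m01) lebesgue01.

Variable p : seq bool -> R.
Hypotheses (p_ge0 : forall w, 0 <= p w) (p_nil : p [::] = 1)
  (p_cons : forall w, p w = p (true :: w) + p (false :: w)).

Definition random_config (x : measurableTypeR R) : configmeas T := fun v => bit p x (e' v).

Let measurable_random_config : measurable_fun setT random_config.
Proof.
have h := @measurability _ _ _ _ setT random_config (@spin_cylinders T).
apply: h => // _ [_ [v ->] <-].
by rewrite setTI; exact: (measurable_bit p (e' v)).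
Qed.

HB.instance Definition _ := isMeasurableFun.Build _ _ _ _ random_config
  measurable_random_config.

(** An explicit Kolmogorov extension: the image of Lebesgue measure on [0, 1[ under successive
    splitting. *)
Lemma word_measure : exists G : probability (configmeas T) R,
  forall w, G [set s | prefix e s (size w) = w] = (p w)%:E.
Proof.
exists (distribution (mrestr (@lebesgue_measure R) m01) random_config) => w.
rewrite -(lebesgue_bits p_ge0 p_nil p_cons) /distribution /pushforward /= /mrestr.
congr (lebesgue_measure (_ `&` _)); apply/seteqP; split => x /=;
  by rewrite (_ : prefix _ _ _ = bits p x (size w))//;
  elim: (size w) => //= n ->; rewrite /random_config eK.
Qed.

End word_measure.

Lemma measurable_spin (T : LT) (v : V T) : measurable [set s : configmeas T | s v].
Proof. by apply: sub_sigma_algebra; exists v. Qed.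

Lemma measurable_prefix (T : LT) (e : nat -> V T) w :
  measurable [set s : configmeas T | prefix e s (size w) = w].
Proof.
elim: w => [|c w IH] /=; first by rewrite (_ : [set _ | _] = setT)//; apply/seteqP.
rewrite (_ : [set _ | _] = [set s | prefix e s (size w) = w] `&` [set s | s (e (size w)) = c]); last first.
  by apply/seteqP; split => s /= [-> ->].
apply: measurableI => //; case: c; first exact: measurable_spin.
rewrite (_ : [set s : configmeas T | s (e (size w)) = false] =
    ~` [set s : configmeas T | s (e (size w))]).
  by apply: measurableC; exact: measurable_spin.
by apply/seteqP; split => s /=; [move=> ->|move/negP/negbTE].
Qed.

(** * Limits of expectations as measures *)

Section limit_functional.
Context {R : realType}.
Variables (T : LT) (e : nat -> V T) (e' : V T -> nat).
Hypotheses (eK : cancel e e') (e'K : cancel e' e).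
Variable E : nat -> (config T -> R) -> R.
Hypotheses (ED : forall N f g, E N (fun s => f s + g s) = E N f + E N g)
  (EZ : forall N c f, E N (fun s => c * f s) = c * E N f)
  (E1 : forall N, E N (fun=> 1) = 1)
  (Ele : forall N f g, (forall s, f s <= g s) -> E N f <= E N g)
  (Ecvg : forall n f, prefix_local e n f -> cvgn (E^~ f)).

Let Ecst N c : E N (fun=> c) = c.
Proof. by have := EZ N c (fun=> 1); rewrite E1 mulr1. Qed.

Lemma limit_measure_ex : exists G : probability (configmeas T) R,
  forall w, G [set s | prefix e s (size w) = w] = (limn (E^~ (cylinder e w)))%:E.
Proof.
apply: (word_measure (e' := e')) => //.
- move=> w; apply: limr_ge; first exact: Ecvg (@cylinder_local _ e _ w).
  by near=> N; rewrite -(Ecst N 0); apply: Ele => s; exact: ler0n.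
- have -> : cylinder e [::] = (fun=> 1) :> (_ -> R) by apply/funext.
  by under eq_fun do rewrite Ecst; rewrite lim_cst.
- move=> w; rewrite -limD; try exact: Ecvg (@cylinder_local _ e _ _).
  congr (limn _); apply/funext => N; rewrite -[RHS]/(E N _ + E N _) -ED; congr E; apply/funext => s.
  rewrite /cylinder /= !eqseq_cons.
  by case: (s _); rewrite /= ?addr0 ?add0r.
Unshelve. all: by end_near. Qed.

(** The limits on cylinders are consistent masses and define [G]. Convergence extends by linearity
    to functions of a prefix, then to continuous functions by uniform approximation. *)
Lemma limit_measure : exists G : probability (configmeas T) R,
  (forall f : {ptws V T -> bool} -> R, continuous f ->
    (E N f)%:E @[N --> \oo] --> (\int[G]_s (f s)%:E)%E).
Proof.
have [G GE] := limit_measure_ex; exists G.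
pose Q f := G.-integrable setT (EFin \o f : configmeas T -> _) /\
  E N f @[N --> \oo] --> Rintegral G setT f.
have icst c : G.-integrable setT (EFin \o (fun=> c) : configmeas T -> _).
  exact: finite_measure_integrable_cst.
have Qlocal n f : prefix_local e n f -> Q f.
  apply: cylinder_ind.
  - move=> g h [ig cg] [ih ch]; split; first exact: (integrableD _ ig ih).
    rewrite RintegralD//.
    have H : (fun N => E N g + E N h) @ \oo --> Rintegral G setT g + Rintegral G setT h.
      exact: cvgD.
    rewrite (_ : (fun N => E N g + E N h) = (fun N => E N (fun s => g s + h s))) in H => //.
    by apply/funext => N; rewrite ED.
  - move=> c g [ig cg]; split; first exact: (integrableZl _ c ig).
    rewrite RintegralZl//.
    have H : (fun N => c * E N g) @ \oo --> c * Rintegral G setT g.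
      by apply: cvgM => //; exact: cvg_cst.
    rewrite (_ : (fun N => c * E N g) = (fun N => E N (fun s => c * g s))) in H => //.
    by apply/funext => N; rewrite EZ.
  - move=> w; have mw := measurable_prefix e w.
    have cE : cylinder e w = \1_[set s : configmeas T | prefix e s (size w) = w] :> (_ -> R).
      apply/funext => s; rewrite /cylinder indicE.
      by case: eqP => h; [rewrite mem_set|rewrite memNset].
    split; first by rewrite cE; exact: integrable_indic.
    have -> : Rintegral G setT (cylinder e w) = limn (E^~ (cylinder e w)).
      by rewrite {1}cE /Rintegral integral_indic// setIT; exact: (congr1 fine (GE w)).
    exact: Ecvg (@cylinder_local _ e _ w).
have e_surj v : exists n, v = e n by exists (e' v); rewrite e'K.
move=> f cf.
(* Resetting the spins from index n on turns [f] into a function of a prefix. *)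
pose s_ n (s : V T -> bool) : V T -> bool := fun v => if (e' v < n)%N then s v else false.
have s_prefix n s : prefix e (s_ n s) n = prefix e s n.
  by apply/eq_prefix => i ilt; rewrite /s_ eK ilt.
have fs_local n : prefix_local e n (fun s => f (s_ n s)).
  move=> s t /eq_prefix st; congr f; apply/funext => v; rewrite /s_.
  by case: ifP => // vn; rewrite -(e'K v) st.
have mf : measurable_fun [set: configmeas T] f.
  have := @measurable_fun_cvg _ (configmeas T) R setT
    (fun n (s : configmeas T) => f (s_ n s)) f; apply.
    by move=> n; have [/measurable_int/measurable_EFinP] := Qlocal _ _ (fs_local n).
  move=> s _; apply: (@cvg_comp _ _ _ (fun n => s_ n s : {ptws V T -> bool}) f _ (nbhs (s : {ptws V T -> bool}))).
    by apply: (prefix_cvg e_surj) => n; exact: s_prefix.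
  exact: cf.
have approx eps : 0 < eps -> exists g, Q g /\ forall s, `|f s - g s| <= eps.
  move=> eps0; have [n fn] := continuous_prefix e_surj cf eps0.
  exists (fun s => f (s_ n s)); split; first exact: Qlocal (fs_local n).
  by move=> s; rewrite ltW// fn// s_prefix.
have fint : G.-integrable setT (EFin \o f : configmeas T -> _).
  have [g [[ig _] fg]] := approx 1 ltr01.
  apply: (le_integrable measurableT _ _ (integrableD measurableT (integrable_norm ig) (icst 1))).
    exact/measurable_EFinP.
  move=> s _; rewrite /= lee_fin [leRHS]ger0_norm ?addr_ge0//.
  by have := fg s; have := ler_normD (g s) (f s - g s); rewrite [g s + _]addrC subrK; lra.
have fE : (\int[G]_s (f s)%:E)%E = (Rintegral G setT f)%:E.
  by rewrite /Rintegral fineK//; exact: integrable_fin_num.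
rewrite fE; apply: cvg_EFin; first by near=> N.
have Rle g h c : G.-integrable setT (EFin \o g : configmeas T -> _) ->
    G.-integrable setT (EFin \o h : configmeas T -> _) ->
    (forall s, g s <= h s + c) -> Rintegral G setT g <= Rintegral G setT h + c.
  move=> ig ih gh; have -> : c = Rintegral G setT (fun=> c).
    rewrite Rintegral_cst// -[LHS]mulr1; congr (_ * _).
    exact/esym/(congr1 fine (probability_setT G)).
  rewrite -RintegralD//; apply: le_Rintegral => //; exact: (integrableD _ ih (icst c)).
have EEle N g h c : (forall s, g s <= h s + c) -> E N g <= E N h + c.
  by move=> gh; rewrite -[X in _ + X](Ecst N) -ED; exact: Ele.
apply/cvgrPdist_lt => eps eps0.
have e3 : 0 < eps / 3 by rewrite divr_gt0.
have [g [[ig cg] fg]] := approx _ e3.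
have fg1 s : f s <= g s + eps / 3 by have := fg s; rewrite ler_norml => /andP[_]; lra.
have gf1 s : g s <= f s + eps / 3 by have := fg s; rewrite ler_norml => /andP[+ _]; lra.
near=> N.
have i2 : `|Rintegral G setT g - E N g| < eps / 3.
  by near: N; move/cvgrPdist_lt: cg; apply.
have := Rle _ _ _ fint ig fg1; have := Rle _ _ _ ig fint gf1.
have := EEle N _ _ _ fg1; have := EEle N _ _ _ gf1.
by move: i2; rewrite /= !ltr_norml => /andP[]; move=> *; apply/andP; split; lra.
Unshelve. all: by end_near. Qed.

End limit_functional.

(** * Uniqueness of the Gibbs measure *)

Lemma vertices_enum (T : LT) :
  exists (e : nat -> V T) (e' : V T -> nat), cancel e e' /\ cancel e' e.
Proof.
have infV : ~ finite_set [set: V T].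
  move=> /(finite_image (@level T)); apply: contra_not infinite_nat.
  by congr finite_set; apply/seteqP; split => // j _; exists (vert T j 0).
have cV : countable [set: V T] by exact: (@countableP {j : nat & 'I_(width T j)}).
have /card_set_bijP[f] := eq_card_nat cV infV.
by rewrite setTT_bijective => -[g fK gK]; exists g, f.
Qed.

Section gibbs_uniqueness.
Context {R : realType}.
Variables (T : LT) (beta : R).
Hypothesis beta_ge0 : 0 <= beta.
Implicit Types (f : config T -> R).

Definition lift_config f (t : nat * nat -> bool) : R := f (t \o @site T).

Lemma lift_allup A : lift_config (allup A) = allup (map (@site T) A).
Proof. by apply/funext => t; rewrite /lift_config /allup all_map. Qed.

Lemma lift_dep e n f : prefix_local e n f ->
  depends_on (mem [seq site (e i) | i <- iota 0 n]) (lift_config f).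
Proof.
move=> fn s t st; apply: fn; apply/eq_prefix => i ilt /=; apply: st.
by apply/mapP; exists i => //; rewrite mem_iota.
Qed.

Lemma prefix_local_continuous e n f : prefix_local e n f ->
  continuous (f : {ptws V T -> bool} -> R).
Proof.
move=> fn s; apply: cvg_near_cst.
by have := prefix_nbhs e s n; apply: filterS => t; exact: fn.
Qed.

Lemma allup_continuous A : continuous (allup A : {ptws V T -> bool} -> R).
Proof.
have [e [e' [eK e'K]]] := vertices_enum T.
apply: (@prefix_local_continuous e (\max_(v <- A) (e' v).+1)) => //.
move=> s t /eq_prefix st; rewrite /allup; congr ((_ : bool)%:R).
apply: eq_in_all => v vA; rewrite -(e'K v) st//.
by rewrite (leq_trans _ (leq_bigmax_seq _ vA _)).
Qed.

Lemma measurable_allup A : measurable [set s : configmeas T | all s A].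
Proof.
elim: A => [|v A IH] /=; first by rewrite (_ : [set _ | _] = setT)//; apply/seteqP.
rewrite (_ : [set _ | _] = [set s : configmeas T | s v] `&` [set s : configmeas T | all s A]).
  by apply: measurableI => //; exact: measurable_spin.
by apply/seteqP; split => s /=; [move=> /andP|move=> [-> ->]].
Qed.

Lemma integral_allup (G : probability (configmeas T) R) A :
  (\int[G]_s (allup A s)%:E)%E = G [set s : configmeas T | all s A].
Proof.
transitivity (\int[G]_(s in setT) (\1_[set s : configmeas T | all s A] s)%:E)%E.
  apply: eq_integral => s _; rewrite /allup indicE.
  by case: (boolP (all s A)) => h; [rewrite mem_set|rewrite memNset//; apply/negP].
by rewrite integral_indic ?setIT//; exact: measurable_allup.
Qed.

Lemma gibbs_homogeneous (s : nat * nat -> bool) :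
  (forall (D : seq (nat * nat)) F, depends_on (mem D) F ->
    cvgn (fun N => layer_avg T beta N F s)) ->
  exists G : probability (configmeas T) R, forall f : {ptws V T -> bool} -> R,
    continuous f ->
    (ising_expectation beta N (s \o @site T) f)%:E @[N --> \oo] --> (\int[G]_t (f t)%:E)%E.
Proof.
move=> cs; have [e [e' [eK e'K]]] := vertices_enum T.
have [||||n f fn|G GE] := @limit_measure R T e e' eK e'K
  (fun N f => ising_expectation beta N (s \o @site T) f).
- by move=> N f g; rewrite !ising_expectationE /layer_avg -avgD.
- by move=> N c f; rewrite !ising_expectationE /layer_avg -avgZ.
- by move=> N; rewrite !ising_expectationE /layer_avg avg_cst.
- by move=> N f g fg; rewrite !ising_expectationE; apply: le_avg => t; exact: fg.
- have := cs _ _ (lift_dep fn) => /cvg_ex[l hl]; apply/cvg_ex; exists l.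
  rewrite -(cvg_shiftS _ (nbhs l)) in hl.
  rewrite (_ : (fun N => _) = (fun N => layer_avg T beta N.+1 (lift_config f) s)) => //.
  by apply/funext => N; rewrite ising_expectationE.
by exists G.
Qed.

Lemma gibbs_plus : exists G : probability (configmeas T) R, forall f : {ptws V T -> bool} -> R,
    continuous f ->
    (ising_expectation beta N (plus \o @site T) f)%:E @[N --> \oo] --> (\int[G]_t (f t)%:E)%E.
Proof. by apply: gibbs_homogeneous => D F; exact: cvg_layer_avg_plus. Qed.

Lemma gibbs_minus : exists G : probability (configmeas T) R, forall f : {ptws V T -> bool} -> R,
    continuous f ->
    (ising_expectation beta N (minus \o @site T) f)%:E @[N --> \oo] --> (\int[G]_t (f t)%:E)%E.
Proof. by apply: gibbs_homogeneous => D F; exact: cvg_layer_avg_minus. Qed.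

Lemma integral_allup_limit (s : nat * nat -> bool) (G : probability (configmeas T) R) A :
  (forall f : {ptws V T -> bool} -> R, continuous f ->
    (ising_expectation beta N (s \o @site T) f)%:E @[N --> \oo] --> (\int[G]_t (f t)%:E)%E) ->
  layer_avg T beta N (allup (map (@site T) A)) s @[N --> \oo] -->
    fine (G [set s : configmeas T | all s A]).
Proof.
move=> /(_ _ (@allup_continuous A)); rewrite integral_allup => h.
have h' : (ising_expectation beta N (s \o @site T) (allup A))%:E @[N --> \oo] -->
    (fine (G [set s : configmeas T | all s A]))%:E.
  by rewrite fineK// fin_num_measure//; exact: measurable_allup.
rewrite -(cvg_shiftS _ (nbhs (fine _))).
rewrite (_ : [sequence _]_n = (fun N => ising_expectation beta N (s \o @site T) (allup A))).
  exact: fine_cvg h'.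
by apply/funext => N; rewrite ising_expectationE -lift_allup.
Qed.

(** Under any boundary condition the expectation of [allup A] lies between those under - and +,
    which have the same limit. The events that all spins of [A] are + form a generating class closed
    under intersection, so they determine the measure. *)
Lemma no_magnetization_unique : no_magnetization T beta -> unique_gibbs (R := R) T beta.
Proof.
move=> noM; have [G GE] := gibbs_plus; exists G.
split; first by exists id, (fun=> plus \o @site T); split => // m n.
move=> G' [phi [b [phi_incr G'E]]].
have agree A : G' [set s : configmeas T | all s A] = G [set s : configmeas T | all s A].
  have gP := integral_allup_limit (A := A) GE.
  set f := allup (map (@site T) A) in gP.
  have AV : {in map (@site T) A, forall v, v.2 < ups (T v.1)}%N.
    by move=> _ /mapP[v _ ->]; exact: width_site.
  have df : depends_on (mem (map (@site T) A)) f.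
    by move=> s t st; rewrite /f /allup (eq_in_all st).
  have gM : layer_avg T beta N f minus @[N --> \oo] --> fine (G [set s : configmeas T | all s A]).
    have H : (fun N => layer_avg T beta N f plus - gap T beta N f) @ \oo -->
        fine (G [set s : configmeas T | all s A]) - 0.
      by apply: cvgB => //; exact: gap_local df.
    rewrite subr0 (_ : (fun N => _) = (fun N => layer_avg T beta N f minus)) in H => //.
    by apply/funext => N; rewrite /gap; ring.
  have phi_ge n : (n <= phi n)%N.
    by elim: n => // n IH; exact: leq_ltn_trans IH (phi_incr _ _ (ltnSn n)).
  have phi_cvg : (phi n).+1 @[n --> \oo] --> \oo.
    move=> B [N _ NB]; exists N => // n /= Nn; apply: NB => /=.
    exact: leq_trans Nn (leqW (phi_ge n)).
  have h1 : (ising_expectation beta (phi k) (b k) (allup A))%:E @[k --> \oo] -->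
      G' [set s : configmeas T | all s A].
    by rewrite -integral_allup; apply: G'E; exact: allup_continuous.
  have h2 : (ising_expectation beta (phi k) (b k) (allup A))%:E @[k --> \oo] -->
      (fine (G [set s : configmeas T | all s A]))%:E.
    apply: cvg_EFin; first by near=> N.
    apply: (@squeeze_cvgr _ _ _ _ (fun k => layer_avg T beta (phi k).+1 f minus)
      (fun k => layer_avg T beta (phi k).+1 f plus)).
    - near=> k; rewrite /= -[b k](extendK (T := T)) ising_expectationE.
      rewrite -/(lift_config (allup A)) lift_allup.
      by apply/andP; split; apply: avg_mono => //;
        do ?[exact: allup_ge0|exact: allup_incr|exact: spinle_plus|exact: spinle_minus].
    - exact: (cvg_comp _ _ phi_cvg gM).
    - exact: (cvg_comp _ _ phi_cvg gP).
  have := cvg_unique _ h1 h2 => ->//.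
  by rewrite fineK// fin_num_measure//; exact: measurable_allup.
pose C : set (set (configmeas T)) := [set B | exists A, B = [set s : configmeas T | all s A]].
have CT : C setT by exists [::]; apply/seteqP.
move=> B mB; apply: (@g_sigma_algebra_measure_unique _ _ (configmeas T) C _ (fun=> setT)) => //.
- by move=> _ [A ->]; exact: measurable_allup.
- by apply/seteqP; split => // t _; exists 0%N.
- move=> _ _ [A ->] [A' ->]; exists (A ++ A'); apply/seteqP; split => t /=; rewrite all_cat.
    by move=> [-> ->].
  by move=> /andP.
- by move=> _ [A ->]; exact: agree.
- by move=> _; rewrite (le_lt_trans (probability_le1 G' measurableT))// ltry.
- apply: sub_sigma_algebra2 mB => _ [v ->]; exists [:: v].
  by apply/seteqP; split => t /=; rewrite andbT.
Unshelve. all: by end_near. Qed.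

(** The limits under + and under - are both Gibbs measures; when they coincide, the gap tends to
    0. *)
Lemma unique_no_magnetization : unique_gibbs (R := R) T beta -> no_magnetization T beta.
Proof.
move=> [G [_ Guniq]] v vT.
have [Gp GpE] := gibbs_plus; have [Gm GmE] := gibbs_minus.
have hp : gibbs beta Gp by exists id, (fun=> plus \o @site T); split => // m n.
have hm : gibbs beta Gm by exists id, (fun=> minus \o @site T); split => // m n.
have := integral_allup_limit (A := [:: vert T v.1 v.2]) GpE.
have := integral_allup_limit (A := [:: vert T v.1 v.2]) GmE.
rewrite (Guniq _ hp _ (measurable_allup _)) (Guniq _ hm _ (measurable_allup _)) /= site_vert_small// => cm cp.
by have H := cvgB cp cm; rewrite subrr in H; exact: H.
Qed.

Lemma unique_gibbsP : unique_gibbs (R := R) T beta <-> no_magnetization (R := R) T beta.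
Proof. by split; [exact: unique_no_magnetization|exact: no_magnetization_unique]. Qed.

End gibbs_uniqueness.

(** * Galton-Watson processes with geometric offspring *)

Section esum_extra.
Context {R : realType}.

(** One inequality follows from finite sums; applying it to the inverse of [c] gives the other. *)
Lemma esumZl (I : choiceType) (D : set I) (a : I -> \bar R) (c : R) :
  0 <= c -> (forall i, 0 <= a i)%E ->
  (\esum_(i in D) (c%:E * a i) = c%:E * \esum_(i in D) a i)%E.
Proof.
rewrite le_eqVlt => /orP[/eqP <- _|c0 a0].
  by rewrite mul0e; apply: esum1 => i _; rewrite mul0e.
have half (b : I -> \bar R) (d : R) : 0 < d -> (forall i, 0 <= b i)%E ->
    (\esum_(i in D) (d%:E * b i) <= d%:E * \esum_(i in D) b i)%E.
  move=> d0 b0; apply: ge_ereal_sup => _ [X [finX XD] <-].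
  by rewrite -ge0_mule_fsumr// lee_pmul2l// ?lte_fin//; apply: esum_ge; exists X.
apply/eqP; rewrite eq_le half//=.
have ca0 i : (0 <= c%:E * a i)%E by rewrite mule_ge0// lee_fin ltW.
have ci0 : 0 < c^-1 by rewrite invr_gt0.
have := half (fun i => c%:E * a i)%E _ ci0 ca0.
rewrite (eq_esum (b := a)); last first.
  by move=> i _; rewrite muleA -EFinM mulVf ?gt_eqF// mul1e.
move=> /(lee_wpmul2l (x := c%:E)); rewrite lee_fin => /(_ (ltW c0)).
by rewrite muleA -EFinM mulfV ?gt_eqF// mul1e.
Qed.

(** The generating function of the offspring law. *)
Lemma esum_geometric (q : R) : 0 <= q <= 1 ->
  (\esum_(a in [set: nat]) (2^-1 ^+ a.+1 * q ^+ a)%:E = ((2 - q)^-1)%:E)%E.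
Proof.
move=> /andP[q0 q1]; rewrite -nneseries_esumT; last first.
  by move=> n; rewrite lee_fin mulr_ge0// exprn_ge0// invr_ge0.
have Z : `|q / 2| < 1 by rewrite ger0_norm ?divr_ge0//; lra.
have := @cvg_geometric_series R 2^-1 (q / 2) Z.
have -> : 2^-1 * (1 - q / 2)^-1 = (2 - q)^-1.
  by field; rewrite !gt_eqF//; lra.
move=> h; apply/cvg_lim => //.
rewrite (_ : (fun n => _) = EFin \o series (geometric 2^-1 (q / 2))).
  exact: cvg_comp h _.
apply/funext => n /=; rewrite /series /= -sumEFin; apply: eq_bigr => i _.
by congr EFin; rewrite /geometric /= exprMn exprS; ring.
Qed.

End esum_extra.

(** * Generations of the process and extinction *)

Section offspring.
Context {R : realType}.
Implicit Types (f g : nat -> \bar R) (q : R).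

(* One generation of a Galton-Watson process with offspring law a |-> 2^-(a+1), started
   from m individuals. *)
Fixpoint offspring m f : \bar R :=
  if m is m'.+1 then
    (\esum_(a in [set: nat]) ((2^-1 ^+ a.+1)%:E * offspring m' (fun x => f (a + x)%N)))%E
  else f 0%N.

Lemma pow2V_ge0 n : (0 <= (2^-1 ^+ n)%:E :> \bar R)%E.
Proof. by rewrite lee_fin exprn_ge0// invr_ge0. Qed.

Lemma eq_offspring m f g : f =1 g -> offspring m f = offspring m g.
Proof. by move=> /funext ->. Qed.

Lemma offspring_ge0 m f : (forall x, 0 <= f x)%E -> (0 <= offspring m f)%E.
Proof.
elim: m f => //= m IH f f0; apply: esum_ge0 => a _.
by apply: mule_ge0; [exact: pow2V_ge0|exact: IH].
Qed.

Lemma le_offspring m f g : (forall x, 0 <= f x)%E -> (forall x, f x <= g x)%E ->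
  (offspring m f <= offspring m g)%E.
Proof.
elim: m f g => [|m IH] f g f0 fg //=; apply: le_esum => a _.
by apply: lee_wpmul2l; [exact: pow2V_ge0|exact: IH].
Qed.

Lemma offspringD m f g : (forall x, 0 <= f x)%E -> (forall x, 0 <= g x)%E ->
  (offspring m (fun x => f x + g x) = offspring m f + offspring m g)%E.
Proof.
elim: m f g => //= m IH f g f0 g0; rewrite -esumD.
- by apply: eq_esum => a _; rewrite IH// ge0_muleDr//; exact: offspring_ge0.
- by move=> a _; apply: mule_ge0; [exact: pow2V_ge0|exact: offspring_ge0].
- by move=> a _; apply: mule_ge0; [exact: pow2V_ge0|exact: offspring_ge0].
Qed.

Lemma offspringZ m c f : 0 <= c -> (forall x, 0 <= f x)%E ->
  (offspring m (fun x => c%:E * f x) = c%:E * offspring m f)%E.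
Proof.
move=> c0; elim: m f => //= m IH f f0; rewrite -esumZl//.
  by apply: eq_esum => a _; rewrite IH// muleCA.
by move=> a; apply: mule_ge0; [exact: pow2V_ge0|exact: offspring_ge0].
Qed.

(** The branching property: the two groups reproduce independently. *)
Lemma offspring_add m n f :
  offspring (m + n) f = offspring m (fun x => offspring n (fun y => f (x + y)%N)).
Proof.
elim: m f => [|m IH] f; first by rewrite add0n /=; apply: eq_offspring => x; rewrite add0n.
rewrite addSn /=; apply: eq_esum => a _; rewrite IH; congr (_ * _)%E.
apply: eq_offspring => x; apply: eq_offspring => y; by rewrite addnA.
Qed.

Lemma offspring_geometric m q : 0 <= q <= 1 ->
  offspring m (fun x => (q ^+ x)%:E) = ((2 - q)^-1 ^+ m)%:E.
Proof.
move=> q01; have q0 : 0 <= q by case/andP: q01.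
elim: m => [|m IH]; first by rewrite /= !expr0.
rewrite /= (eq_esum (b := fun a => (((2 - q)^-1 ^+ m)%:E * (2^-1 ^+ a.+1 * q ^+ a)%:E)%E)); last first.
  move=> a _; under eq_offspring do rewrite exprD EFinM.
  rewrite offspringZ ?exprn_ge0//; last by move=> x; rewrite lee_fin exprn_ge0.
  by rewrite IH -!EFinM; congr EFin; ring.
rewrite esumZl ?esum_geometric//; last first.
- by move=> a; rewrite lee_fin mulr_ge0// exprn_ge0// invr_ge0.
- by rewrite exprn_ge0// invr_ge0; case/andP: q01; lra.
by rewrite -EFinM -exprSr.
Qed.

(** The probability that the line of one individual is extinct after k generations: by
    [extinctionS], the k-th iterate of the generating function q -> 1 / (2 - q) at 0. *)
Definition extinction k : R := k%:R / k.+1%:R.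

Lemma extinction01 k : 0 <= extinction k <= 1.
Proof.
rewrite /extinction divr_ge0//= ler_pdivrMr// mul1r ler_nat; exact: leqnSn.
Qed.

Lemma extinctionS k : (2 - extinction k)^-1 = extinction k.+1.
Proof.
rewrite /extinction -[k.+2%:R]natr1 -[k.+1%:R]natr1.
have : 0 <= k%:R :> R by exact: ler0n.
by move=> k0; field; rewrite !gt_eqF//; lra.
Qed.

Definition superadditive q (f : nat -> R) :=
  forall x y, f x * q ^+ y + q ^+ x * f y <= f (x + y)%N.

(* The two terms f x q^y and q^x f y stand for the disjoint events that one of two groups of
   individuals, of sizes x and y, dies out. *)
Lemma superadditive_offspring q (f g : nat -> R) : 0 <= q <= 1 ->
  (forall x, 0 <= f x) -> (forall x, 0 <= g x) ->
  (forall m, offspring m (EFin \o f) = (g m)%:E) ->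
  superadditive q f -> superadditive (2 - q)^-1 g.
Proof.
move=> q01 f0 g0 fg sf m n.
have q0 : 0 <= q by case/andP: q01.
have qx0 x : (0 <= (q ^+ x)%:E :> \bar R)%E by rewrite lee_fin exprn_ge0.
rewrite -lee_fin -fg offspring_add EFinD !EFinM -!offspring_geometric// -!fg.
have -> : (offspring m (EFin \o f) * offspring n (fun x => (q ^+ x)%:E) +
    offspring m (fun x => (q ^+ x)%:E) * offspring n (EFin \o f) =
    offspring m (fun x => offspring n (fun y => (f x * q ^+ y + q ^+ x * f y)%:E)))%E.
  have E x : offspring n (fun y => (f x * q ^+ y + q ^+ x * f y)%:E) =
      (((2 - q)^-1 ^+ n)%:E * (f x)%:E + (g n)%:E * (q ^+ x)%:E)%E.
    rewrite (eq_offspring _ (g := fun y => ((f x)%:E * (q ^+ y)%:E + (q ^+ x)%:E * (EFin \o f) y)%E)); last first.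
      by move=> y; rewrite EFinD !EFinM.
    rewrite offspringD; last 2 first.
    - by move=> y; rewrite mule_ge0// lee_fin.
    - by move=> y; rewrite mule_ge0// lee_fin.
    rewrite !offspringZ ?exprn_ge0//.
    by rewrite fg offspring_geometric// [X in (X + _)%E]muleC [X in (_ + X)%E]muleC.
  under [RHS]eq_offspring do rewrite E.
  have Q0 : 0 <= (2 - q)^-1 ^+ n by rewrite exprn_ge0// invr_ge0; case/andP: q01; lra.
  rewrite offspringD; last 2 first.
  - by move=> y; rewrite mule_ge0// lee_fin.
  - by move=> y; rewrite mule_ge0// lee_fin.
  rewrite !offspringZ// -[offspring m (fun x => (f x)%:E)]/(offspring m (EFin \o f)).
  by rewrite !fg !offspring_geometric// -!EFinM; congr (_%:E + _%:E)%E; rewrite mulrC.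
have F0 x y : (0 <= (f x * q ^+ y + q ^+ x * f y)%:E :> \bar R)%E.
  by rewrite lee_fin addr_ge0// mulr_ge0// exprn_ge0.
apply: le_offspring => [x|x]; first exact: offspring_ge0.
by apply: le_offspring => // y; rewrite lee_fin; exact: sf.
Qed.

Lemma extinction_cvg : extinction k @[k --> \oo] --> (1 : R).
Proof.
have h : (fun k => 1 - k.+1%:R^-1 : R) @ \oo --> (1 - 0 : R).
  by apply: cvgB; [exact: cvg_cst|exact: cvg_harmonic].
rewrite subr0 in h; rewrite (_ : extinction = (fun k => 1 - k.+1%:R^-1)) //.
apply/funext => k; rewrite /extinction -natr1.
have : 0 <= k%:R :> R by exact: ler0n.
by move=> k0; field; rewrite gt_eqF//; lra.
Qed.

Lemma extinction_exp_cvg n : extinction k ^+ n @[k --> \oo] --> (1 ^+ n : R).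
Proof.
elim: n => [|n IH]; first by rewrite expr0; exact: cvg_cst.
have h : (fun k => extinction k * extinction k ^+ n) @ \oo --> (1 * 1 ^+ n : R).
  by apply: cvgM IH; exact: extinction_cvg.
rewrite exprS (_ : (fun k => _) = (fun k => extinction k * extinction k ^+ n)) //.
by apply/funext => k; rewrite exprS.
Qed.

(** As k grows the extinction probability tends to 1, and f m + f 1 <= f (m + 1) remains. *)
Lemma superadditive_limit (f : nat -> R) : (forall k, superadditive (extinction k) f) ->
  f 0%N = 0 -> forall m, m%:R * f 1%N <= f m.
Proof.
move=> sf f00; elim=> [|m IH]; first by rewrite mul0r f00.
have : f m * 1 ^+ 1 + 1 ^+ m * f 1%N <= f (m + 1)%N.
  have h : (fun k => f m * extinction k ^+ 1 + extinction k ^+ m * f 1%N) @ \oo -->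
      (f m * 1 ^+ 1 + 1 ^+ m * f 1%N : R).
    by apply: cvgD; apply: cvgM; do ?exact: cvg_cst; exact: extinction_exp_cvg.
  apply: (cvgr_to_le h); near=> k; exact: sf.
rewrite expr1n mulr1 expr1n mul1r addn1 -natr1; lra.
Unshelve. all: by end_near. Qed.

End offspring.

Section words.
Context {R : realType}.

(** The default true admits the empty word, the only one for m = 0. Unlike in strips, false may be
    absent, which is extinction. *)
Definition words m : set (seq bool) := [set w | head true w /\ ups w = m].

Lemma words0 : words 0 = [set [::]].
Proof.
apply/seteqP; split => w /=; last by move=> ->.
by case: w => [|[] w] // [].
Qed.

Definition add_children (p : nat * seq bool) : seq bool := true :: nseq p.1 false ++ p.2.

Lemma add_children_bij m :
  set_bij ([set: nat] `*` words m) (words m.+1) add_children.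
Proof.
split.
- move=> [a w] [_ [hw uw]] /=; split => //; rewrite /ups /= count_cat.
  by rewrite count_nseq -uw.
- move=> [a w] [a' w'] /set_mem[_ [/= hw _]] /set_mem[_ [/= hw' _]] [].
  elim: a a' => [|a IH] [|a'] //=.
  + by move=> ->.
  + by move=> ww; rewrite ww in hw.
  + by move=> ww; rewrite -ww in hw'.
  + by move=> [] /IH[-> ->].
- move=> [|[] u] [] //= _ [um].
  exists (find id u, drop (find id u) u) => /=; last first.
    have h : nseq (find id u) false = take (find id u) u.
      by elim: u {um} => //= -[] u IH //=; congr cons.
    by rewrite /add_children /= h cat_take_drop.
  split=> //; elim: u um => //= -[] u IH //=.
Qed.

(** An individual with a children is a block of a + 1 triangles, so the weight of a word is the
    product of its offspring probabilities. *)
Lemma esum_words m (f : nat -> \bar R) : (forall x, 0 <= f x)%E ->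
  (\esum_(w in words m) ((2^-1 ^+ size w)%:E * f (downs w)) = offspring m f)%E.
Proof.
elim: m f => [|m IH] f f0.
  by rewrite words0 esum_set1 /= ?expr0 ?mul1e.
rewrite (@reindex_esum _ _ _ _ _ _ _ (add_children_bij m)) /=.
have -> : [set: nat] `*` words m = [set: nat] `*`` (fun=> words m).
  by apply/seteqP; split => -[].
rewrite -(esum_esum (a := fun a w => ((2^-1 ^+ size (add_children (a, w)))%:E *
  f (downs (add_children (a, w))))%E)); last first.
  by move=> a w _ _; rewrite mule_ge0//; exact: pow2V_ge0.
apply: eq_esum => a _; rewrite -IH; last by move=> x; exact: f0.
rewrite -esumZl; last first.
- by move=> w; rewrite mule_ge0//; exact: pow2V_ge0.
- by rewrite exprn_ge0// invr_ge0.
apply: eq_esum => w _; rewrite muleA -EFinM -exprD /add_children /=.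
rewrite size_cat size_nseq addSn; congr (_ * f _)%E.
by rewrite /downs /= count_cat count_nseq mul1n.
Qed.

End words.

(** * The law of the infinite triangulation *)

Section law.
Context {R : realType}.
Implicit Types (s : seq (seq bool)) (w : seq bool).

(* The default word makes the empty triangulation end on the single edge of S^1 x {0}. *)
Definition top_width s : nat := downs (last [:: false] s).
Definition triangles s : nat := (\sum_(w <- s) size w)%N.

Lemma triangles_rcons s w : triangles (rcons s w) = (triangles s + size w)%N.
Proof. by rewrite /triangles -cats1 big_cat big_seq1. Qed.

Lemma top_width_rcons s w : top_width (rcons s w) = downs w.
Proof. by rewrite /top_width last_rcons. Qed.

Lemma lorentzian_rcons s w :
  lorentzian (rcons s w) = [&& lorentzian s, strip_ok w & ups w == top_width s].
Proof.
rewrite /lorentzian all_rcons /top_width; case: s => [|x s] /=.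
  by rewrite !andbT.
rewrite rcons_path /= [downs _ == _]eq_sym.
by case: (strip_ok w); case: (strip_ok x); case: (all _ _); case: (path _ _ _); rewrite /= ?andbF ?andbT // andbC.
Qed.

Lemma top_width_gt0 s : lorentzian s -> (0 < top_width s)%N.
Proof.
case/lastP: s => [//|s w]; rewrite lorentzian_rcons top_width_rcons.
by move=> /and3P[_ /andP[]].
Qed.

Definition children s : set (seq bool) := [set w | strip_ok w /\ ups w = top_width s].

Definition extensions s k : set (seq (seq bool)) :=
  [set s' | [/\ lorentzian s', size s' = (size s + k)%N & take (size s) s' = s]].

Lemma extensions0 s : lorentzian s -> extensions s 0 = [set s].
Proof.
move=> ls; apply/seteqP; split => s' /=; last by move=> ->; split; rewrite ?addn0 ?take_size.
by move=> [_ sz <-]; rewrite take_oversize// sz addn0.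
Qed.

Lemma extensionsS_bij s k : set_bij (extensions s k `*`` children) (extensions s k.+1)
  (fun p : seq (seq bool) * seq bool => rcons p.1 p.2).
Proof.
split.
- move=> [s' w] [/= [ls sz st] [ow uw]]; split.
  + by rewrite lorentzian_rcons ls ow uw eqxx.
  + by rewrite size_rcons sz addnS.
  + by rewrite -cats1 takel_cat// sz leq_addr.
- by move=> [s' w] [t u] _ _ /= /rcons_inj[-> ->].
- move=> s'; case/lastP: s' => [[_ /=]|s' w [ls]]; first by rewrite addnS.
  rewrite size_rcons addnS => -[sz] st.
  move: ls; rewrite lorentzian_rcons => /and3P[ls ow /eqP uw].
  exists (s', w) => //; split => //=; split => //.
  by move: st; rewrite -cats1 takel_cat// sz leq_addr.
Qed.

Lemma esum_sub (I : choiceType) (A B : set I) (a : I -> \bar R) : A `<=` B ->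
  (forall i, B i -> ~ A i -> a i = 0%E) -> (\esum_(i in A) a i = \esum_(i in B) a i)%E.
Proof.
move=> AB a0; rewrite esum_mkcond [RHS]esum_mkcond; apply: eq_esum => i _.
case: ifPn => [/set_mem/AB/mem_set -> //|/negP iA]; case: ifPn => // /set_mem iB.
by rewrite a0// => Ai; apply: iA; exact: mem_set.
Qed.

(** The words that are not strips have no letter false, and f 0 = 0 removes them from the sum. *)
Lemma esum_children s (f : nat -> \bar R) : lorentzian s -> (forall x, 0 <= f x)%E ->
  f 0%N = 0%E ->
  (\esum_(w in children s) ((2^-1 ^+ size w)%:E * f (downs w)) = offspring (top_width s) f)%E.
Proof.
move=> ls f0 f00; rewrite -esum_words//; apply: esum_sub.
  by move=> [|[] w] [/andP[//= _ _] uw].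
move=> w [hw uw] wN; have -> : downs w = 0%N; last by rewrite f00 mule0.
apply/eqP; rewrite -leqn0 leqNgt; apply/negP => dw; apply: wN; split => //.
apply/andP; split=> //; case: w hw uw {dw} => // _ /esym/eqP.
by rewrite gtn_eqF// top_width_gt0.
Qed.

Lemma esum_extensions s k (f : nat -> \bar R) : lorentzian s -> (forall x, 0 <= f x)%E ->
  f 0%N = 0%E ->
  (\esum_(s' in extensions s k) ((2^-1 ^+ triangles s')%:E * f (top_width s')) =
   (2^-1 ^+ triangles s)%:E * iter k (fun g m => offspring m g) f (top_width s))%E.
Proof.
move=> ls; elim: k f => [|k IH] f f0 f00.
  by rewrite extensions0// esum_set1// mule_ge0//; exact: pow2V_ge0.
rewrite iterSr (@reindex_esum _ _ _ _ _ _ _ (extensionsS_bij s k)) /=.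
rewrite -(esum_esum (a := fun s' w => ((2^-1 ^+ triangles (rcons s' w))%:E *
  f (top_width (rcons s' w)))%E)); last first.
  by move=> s' w _ _; rewrite mule_ge0//; exact: pow2V_ge0.
rewrite -IH; last 2 first.
- by move=> x; exact: offspring_ge0.
- by [].
apply: eq_esum => s' [ls' _ _]; rewrite -esum_children// -esumZl; last 2 first.
- by rewrite exprn_ge0// invr_ge0.
- by move=> w; rewrite mule_ge0//; exact: pow2V_ge0.
by apply: eq_esum => w _; rewrite triangles_rcons top_width_rcons exprD EFinM muleA.
Qed.

(** The probability that m individuals have descendants after k generations; for k = 0 it is the
    indicator of m > 0. *)
Definition survival k (m : nat) : \bar R := (1 - extinction k ^+ m)%:E.

Lemma extinction_exp_le1 k m : (extinction k : R) ^+ m <= 1.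
Proof. by rewrite exprn_ile1//; have /andP[] := @extinction01 R k. Qed.

Lemma survival_ge0 k m : (0 <= survival k m)%E.
Proof. by rewrite lee_fin subr_ge0 extinction_exp_le1. Qed.

Lemma offspring_survival k m : offspring m (survival k) = survival k.+1 m.
Proof.
have := offspringD m (survival_ge0 k) (g := fun x => (extinction k ^+ x)%:E).
rewrite offspring_geometric ?extinction01// extinctionS.
rewrite (eq_offspring _ (g := fun x => (1 ^+ x)%:E)); last first.
  by move=> x; rewrite -EFinD subrK expr1n.
rewrite offspring_geometric ?ler01 ?lexx// => /(_ _) h.
have := h _; rewrite (_ : (2 - 1)^-1 ^+ m = 1 :> R); last first.
  by rewrite (_ : 2 - 1 = 1 :> R) ?invr1 ?expr1n//; lra.
move=> /(_ _) h'; have {h h'} : (1%:E = offspring m (survival k) + (extinction k.+1 ^+ m)%:E :> \bar R)%E.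
  by apply: h' => x; rewrite lee_fin exprn_ge0//; have /andP[] := @extinction01 R k.
by move=> e; rewrite /survival EFinB e addeK.
Qed.

Lemma iter_survival k : iter k (fun g m => offspring m g) (survival 0) = survival k.
Proof.
by elim: k => //= k ->; apply/funext => m; rewrite offspring_survival.
Qed.

Lemma esum_extensions1 s k : lorentzian s ->
  (\esum_(s' in extensions s k) (2^-1 ^+ triangles s')%:E =
   (2^-1 ^+ triangles s)%:E * survival k (top_width s))%E.
Proof.
move=> ls; rewrite -iter_survival -esum_extensions//; last 2 first.
- by move=> x; exact: survival_ge0.
- by rewrite /survival expr0 subrr.
apply: eq_esum => s' [/top_width_gt0 s'0 _ _].
by rewrite /survival /extinction mul0r expr0n gtn_eqF// subr0 mule1.
Qed.

Lemma strips_bij N : set_bij [set: LTfin N] (extensions [::] N)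
  (fun t : LTfin N => strips t : seq (seq bool)).
Proof.
split.
- by move=> t _; split; [exact: stripsP|rewrite size_tuple|rewrite take0].
- by move=> t u _ _ /val_inj /val_inj.
- move=> s [ls sz _]; have sN : size s == N by rewrite sz.
  by exists (@MkLTfin N (Tuple sN) ls).
Qed.

Lemma LT_weight_cr N (t : LTfin N) : LT_weight (mu_cr R) t = 2^-1 ^+ triangles (strips t).
Proof.
rewrite /LT_weight /mu_cr -lnV ?posrE// mulrC expRM_natl lnK ?posrE ?invr_gt0//.
Qed.

(** The partition function is the probability that a single individual has descendants after N
    generations. *)
Lemma LT_partition_cr N : LT_partition N (mu_cr R) = (N.+1%:R^-1)%:E.
Proof.
rewrite /LT_partition (eq_esum (b := fun t : LTfin N => (2^-1 ^+ triangles (strips t))%:E)); last first.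
  by move=> t _; rewrite LT_weight_cr.
rewrite -(@reindex_esum _ _ _ _ _ _ (fun s => (2^-1 ^+ triangles s)%:E) (strips_bij N)).
rewrite esum_extensions1// /triangles big_nil expr0 mul1e /survival /top_width /= expr1.
rewrite /extinction -natr1; congr EFin; have : 0 <= N%:R :> R by exact: ler0n.
by move=> ?; field; rewrite gt_eqF//; lra.
Qed.

Lemma LT_prob_cr M (t : LTfin M) k :
  LT_prob (mu_cr R) [set t' : LTfin (k + M) | take M (strips t') = strips t] =
  ((k + M).+1%:R * (2^-1 ^+ triangles (strips t) *
     (1 - extinction k ^+ top_width (strips t))))%:E.
Proof.
rewrite /LT_prob LT_partition_cr /=.
rewrite (eq_esum (b := fun t' : LTfin (k + M) =>
  ((k + M).+1%:R%:E * (2^-1 ^+ triangles (strips t'))%:E)%E)); last first.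
  by move=> t' _; rewrite LT_weight_cr invrK mulrC EFinM.
rewrite esumZl//.
rewrite EFinM; congr (_ * _)%E; rewrite EFinM -esum_extensions1; last exact: stripsP.
apply/esym; apply: (@reindex_esum _ _ _ _ _ (fun t : LTfin (k + M) => strips t : seq (seq bool))).
split.
- by move=> t' /= tt'; split; rewrite ?size_tuple ?stripsP 1?addnC.
- by move=> t' u _ _ /val_inj /val_inj.
- move=> s [ls sz st]; have sN : size s == (k + M)%N by rewrite sz size_tuple addnC.
  by exists (@MkLTfin _ (Tuple sN) ls) => //; rewrite /= -st size_tuple.
Qed.

Definition starting s : set LT := [set T | mkseq T (size s) = s].

Lemma restr_starting M (t : LTfin M) : [set T | restr M T = t] = starting (strips t).
Proof.
apply/seteqP; split => T /=; rewrite /starting /= size_tuple; first by move=> <-.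
by move=> Tt; apply: val_inj; apply: val_inj.
Qed.

Lemma LT_law (P : probability LTmeas R) : is_LT_weak_limit (mu_cr R) P ->
  forall s, lorentzian s -> P (starting s) = ((top_width s)%:R * 2^-1 ^+ triangles s)%:E.
Proof.
move=> hP s ls; pose M := size s.
pose t : LTfin M := @MkLTfin M (in_tuple s) ls.
rewrite -[s]/(strips t : seq _) -restr_starting; apply: (cvg_unique _ (hP M t)) => //.
rewrite /= -(cvg_shiftn M).
pose w := top_width s; set c := 2^-1 ^+ _.
have E k : LT_prob (mu_cr R) [set t' : LTfin (k + M) | take M (strips t') = strips t] =
    ((1 + M%:R * k.+1%:R^-1) * (c * \sum_(i < w) extinction k ^+ i))%:E.
  rewrite LT_prob_cr -/w -/c; congr EFin.
  (* Factor 1 - q^w as (1 - q)(1 + ... + q^(w - 1)), where 1 - q = 1 / (k + 1) balances the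
     normalization k + M + 1. *)
  have := @subrXX R 1 (extinction k) w; rewrite expr1n => ->.
  rewrite (eq_bigr (fun i : 'I_w => extinction k ^+ i)); last by move=> i _; rewrite expr1n mul1r.
  rewrite [in 1 - _]/extinction -addSn natrD -natr1; set S := \sum_(_ < _) _.
  have : 0 <= k%:R :> R by exact: ler0n.
  by move=> ?; field; rewrite gt_eqF//; lra.
rewrite (_ : [sequence _]_n = EFin \o (fun k => (1 + M%:R * k.+1%:R^-1) * (c * \sum_(i < w) extinction k ^+ i))); last first.
  by apply/funext => k /=; rewrite E.
apply: cvg_EFin; first by near=> N.
have -> : w%:R * c = (1 + M%:R * 0) * (c * \sum_(i < w) 1 ^+ i).
  rewrite mulr0 addr0 mul1r mulrC; congr (_ * _).
  by under eq_bigr do rewrite expr1n; rewrite sumr_const card_ord.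
rewrite /comp /=.
apply: cvgM.
  by apply: cvgD; [exact: cvg_cst|apply: cvgM; [exact: cvg_cst|exact: cvg_harmonic]].
apply: cvgM; first exact: cvg_cst.
elim: w {E} => [|n IH].
  rewrite big_ord0 (_ : (fun k => _) = (fun=> 0)); first exact: cvg_cst.
  by apply/funext => k; rewrite big_ord0.
rewrite big_ord_recr /= (_ : (fun k => _) =
  (fun k => \sum_(i < n) extinction k ^+ i + extinction k ^+ n)).
  by apply: cvgD IH _; exact: extinction_exp_cvg.
by apply/funext => k; rewrite big_ord_recr.
Unshelve. all: by end_near. Qed.

End law.

(** * Zero-one law *)

Section cylinders.

Lemma lorentzian_prefix s r : lorentzian (s ++ r) -> lorentzian s.
Proof.
elim/last_ind: r => [|r w IH]; first by rewrite cats0.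
by rewrite -rcons_cat lorentzian_rcons => /and3P[/IH].
Qed.

Lemma top_width_swap s s' r : top_width s = top_width s' ->
  top_width (s ++ r) = top_width (s' ++ r).
Proof.
case/lastP: r => [|r v]; first by rewrite !cats0.
by rewrite -!rcons_cat !top_width_rcons.
Qed.

(** The strips above see those below only through the number of edges on the common circle. *)
Lemma lorentzian_swap s s' r : lorentzian s' -> top_width s = top_width s' ->
  lorentzian (s ++ r) -> lorentzian (s' ++ r).
Proof.
move=> ls' tss'; elim/last_ind: r => [|r w IH]; first by rewrite !cats0.
rewrite -!rcons_cat !lorentzian_rcons => /and3P[/IH -> -> /=].
by rewrite (top_width_swap r tss').
Qed.

Lemma measurable_starting s : measurable (starting s : set LTmeas).
Proof.
have [ls|nls] := boolP (lorentzian s); last first.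
  rewrite (_ : starting s = set0); first exact: measurable0.
  apply/seteqP; split => T //= Ts; have := stripP T (size s).
  by rewrite Ts; apply/negP.
apply: sub_sigma_algebra; exists (size s), (@MkLTfin (size s) (in_tuple s) ls).
by rewrite restr_starting.
Qed.

Lemma starting_nil : starting [::] = setT.
Proof. by apply/seteqP. Qed.

Lemma startingI u v : (size u <= size v)%N ->
  starting u `&` starting v = if take (size u) v == u then starting v else set0.
Proof.
move=> uv; case: eqP => [uE|uN].
  apply/seteqP; split => T /=; first by case.
  move=> Tv; split => //; rewrite /starting /= -uE -Tv size_takel ?size_mkseq//.
  by rewrite /mkseq -map_take take_iota (minn_idPl _).
apply/seteqP; split => T //= [Tu Tv]; apply: uN; rewrite -Tv -[RHS]Tu.
by rewrite /mkseq -map_take take_iota (minn_idPl _).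
Qed.

Definition prefix_determined n (X : set LT) :=
  forall T T' : LT, mkseq T n = mkseq T' n -> X T -> X T'.

Lemma measurable_prefix_determined n (X : set LTmeas) :
  prefix_determined n X -> measurable X.
Proof.
move=> Xn.
have -> : X = \bigcup_s (if `[< size s = n /\ exists2 T, X T & mkseq T n = s >]
    then starting s else set0).
  apply/seteqP; split => T.
    move=> XT; exists (mkseq T n) => //; case: asboolP => [_|[]].
      by rewrite /starting /= size_mkseq.
    by split; [rewrite size_mkseq|exists T].
  move=> [s _]; case: asboolP => // -[sn [T' XT' T's]]; rewrite /starting /= sn => Ts.
  by apply: Xn XT'; rewrite T's Ts.
apply: countable_bigcupT_measurable; first exact: countableP.
by move=> s; case: asboolP => _; [exact: measurable_starting|exact: measurable0].
Qed.

Definition lorentzian_cylinders : set (set LTmeas) :=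
  [set B | B = set0 \/ exists2 s, lorentzian s & B = starting s].

Lemma lorentzian_cylinders_setI : setI_closed lorentzian_cylinders.
Proof.
have I u v : (size u <= size v)%N -> lorentzian v ->
    lorentzian_cylinders (starting u `&` starting v).
  by move=> uv lv; rewrite startingI//; case: ifP => _; [right; exists v|left].
move=> A B [->|[u lu ->]] [->|[v lv ->]]; do ?by left; rewrite ?set0I ?setI0.
have [uv|/ltnW vu] := leqP (size u) (size v); first exact: I.
by rewrite setIC; exact: I.
Qed.

Context {R : realType}.

(** Two cylinders are nested or disjoint, so together with the empty set they are closed under
    intersection. *)
Lemma eq_LT_measure (m1 m2 : {measure set LTmeas -> \bar R}) :
  (m1 setT < +oo)%E -> (forall s, lorentzian s -> m1 (starting s) = m2 (starting s)) ->
  forall B, measurable B -> m1 B = m2 B.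
Proof.
move=> fin m12 B mB.
apply: (@g_sigma_algebra_measure_unique _ _ LTmeas lorentzian_cylinders _ (fun=> setT)) => //.
- by move=> _ [->|[s _ ->]]; [exact: measurable0|exact: measurable_starting].
- by move=> _; right; exists [::] => //; rewrite starting_nil.
- by apply/seteqP; split => // T _; exists 0%N.
- exact: lorentzian_cylinders_setI.
- by move=> _ [->|[s ls ->]]; rewrite ?measure0// m12.
- apply: sub_sigma_algebra2 mB => _ [M [t ->]]; right; exists (strips t); first exact: stripsP.
  by rewrite restr_starting.
Qed.

Lemma esum_measure d (X : measurableType d) (mu : {measure set X -> \bar R})
    (I : countType) (D : set I) (F : I -> set X) :
  (forall i, measurable (F i)) -> trivIset D F ->
  mu (\bigcup_(i in D) F i) = (\esum_(i in D) mu (F i))%E.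
Proof.
move=> mF tF.
pose D' : set nat := pickle @` D.
pose F' n := if unpickle n is Some i then F i else set0.
have -> : \bigcup_(i in D) F i = \bigcup_(n in D') F' n.
  apply/seteqP; split => x.
    by move=> [i Di Fi]; exists (pickle i); [exists i|rewrite /F' pickleK].
  by move=> [_ [i Di <-]]; rewrite /F' pickleK => Fi; exists i.
rewrite measure_bigcup; last 2 first.
- by move=> _ [i _ <-]; rewrite /F' pickleK.
- move=> _ _ [i Di <-] [j Dj <-]; rewrite /F' !pickleK => ij.
  by congr pickle; exact: tF.
rewrite nneseries_esum//; rewrite (_ : [set _ | _] = D'); last first.
  by apply/seteqP; split => n /=; rewrite inE.
rewrite esum_image; first by apply: eq_esum => i _; rewrite /F' pickleK.
by move=> i j _ _ /(pcan_inj pickleK).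
Qed.

End cylinders.

(** * Exchange of the first strips *)

Section prefix_exchange.
Variables s s' : seq (seq bool).
Hypotheses (ls' : lorentzian s') (sz : size s = size s')
  (tw : top_width s = top_width s').

Lemma exchange_ex (T : LT) : exists T' : LT,
  if mkseq T (size s) == s
  then forall j, T' j = if (j < size s)%N then nth [::] s' j else T j
  else T' = T.
Proof.
case: eqP => Ts; last by exists T.
pose f j := if (j < size s)%N then nth [::] s' j else T j.
suff lf N : lorentzian (mkseq f N) by exists (MkLT lf).
have E n : mkseq f (size s + n) = s' ++ map T (iota (size s) n).
  rewrite /mkseq iotaD map_cat add0n; congr (_ ++ _).
    rewrite sz; apply: (@eq_from_nth _ [::]); rewrite ?size_map ?size_iota// => i ilt.
    by rewrite (nth_map 0%N) ?size_iota// nth_iota// add0n /f sz ilt.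
  by apply/eq_in_map => j; rewrite mem_iota /f => /andP[+ _]; case: ltnP.
have lsn n : lorentzian (s' ++ map T (iota (size s) n)).
  apply: (lorentzian_swap ls' tw); rewrite -[X in X ++ _]Ts.
  by rewrite /mkseq -map_cat -[X in iota X n]add0n -iotaD; exact: stripP.
have [Ns|sN] := leqP (size s) N; first by rewrite -(subnKC Ns) E.
have := lsn 0%N; rewrite /= cats0 => h.
apply: (@lorentzian_prefix _ (drop N s')); rewrite (_ : mkseq f N = take N s') ?cat_take_drop//.
have := E 0%N; rewrite addn0 /= cats0 => <-.
by rewrite /mkseq -map_take take_iota (minn_idPl (ltnW sN)).
Qed.

Definition exchange (T : LT) : LT := projT1 (cid (exchange_ex T)).

Lemma exchange_in (T : LT) : starting s T ->
  forall j, exchange T j = if (j < size s)%N then nth [::] s' j else T j.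
Proof.
by move=> Ts; rewrite /exchange; case: cid => T' /=; rewrite Ts eqxx.
Qed.

Lemma exchange_out (T : LT) : ~ starting s T -> exchange T = T.
Proof. by move=> Ts; rewrite /exchange; case: cid => T' /=; case: eqP. Qed.

Lemma mkseq_exchange (T : LT) n : starting s T ->
  mkseq (exchange T) (size s + n) = s' ++ map T (iota (size s) n).
Proof.
move=> Ts; rewrite /mkseq iotaD map_cat add0n; congr (_ ++ _).
  rewrite sz; apply: (@eq_from_nth _ [::]); rewrite ?size_map ?size_iota// => i ilt.
  by rewrite (nth_map 0%N) ?size_iota// nth_iota// add0n exchange_in// sz ilt.
by apply/eq_in_map => j; rewrite mem_iota exchange_in// => /andP[+ _]; case: ltnP.
Qed.

Lemma eq_mkseq (f g : nat -> seq bool) n :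
  mkseq f n = mkseq g n <-> forall j, (j < n)%N -> f j = g j.
Proof.
split=> [fg j jn|fg]; first by rewrite -(nth_mkseq [::] f jn) fg nth_mkseq.
by apply/eq_in_map => j; rewrite mem_iota add0n => /fg.
Qed.

Lemma measurable_exchange : measurable_fun [set: LTmeas] (exchange : LTmeas -> LTmeas).
Proof.
have h := @measurability _ _ LTmeas LTmeas setT exchange LT_cylinders.
apply: h => // _ [_ [M [t ->]] <-]; rewrite setTI restr_starting.
(* These strips decide whether T starts with [s] and what the image is up to the height of [t]. *)
apply: (@measurable_prefix_determined (size s + size (strips t))) => T T' TT'.
have Tj j : (j < size s + size (strips t))%N -> T j = T' j.
  exact: (eq_mkseq _ _ _).1.
have cTT' : starting s T <-> starting s T'.
  rewrite /starting /= (_ : mkseq T (size s) = mkseq T' (size s))//.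
  by apply/eq_mkseq => j js; apply: Tj; exact: ltn_addr.
rewrite /preimage /starting /= (_ : mkseq (exchange T) _ = mkseq (exchange T') (size (strips t)))//.
apply/eq_mkseq => j jt.
have [Ts|Ts] := pselect (starting s T).
  rewrite !exchange_in//; last exact: cTT'.1.
  by case: ifP => // _; apply: Tj; exact: ltn_addl.
rewrite !exchange_out//; first by apply: Tj; exact: ltn_addl.
by move=> /cTT'.2.
Qed.

End prefix_exchange.

(** * Tail events *)

Section zero_one.
Context {R : realType}.
Variable P : probability LTmeas R.
Hypothesis law : forall s, lorentzian s ->
  P (starting s) = ((top_width s)%:R * 2^-1 ^+ triangles s)%:E.

Definition tail_set (A : set LTmeas) := forall (T T' : LT) n,
  (forall j, (n <= j)%N -> T j = T' j) -> A T -> A T'.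

Lemma tail_setC A : tail_set A -> tail_set (~` A).
Proof.
move=> tA T T' n TT' nAT AT'; apply/nAT/(tA T' T n) => // j nj.
by rewrite TT'.
Qed.

Lemma triangles_cat s r : triangles (s ++ r) = (triangles s + triangles r)%N.
Proof. by rewrite /triangles big_cat. Qed.

(* Replacing the first strips s by s' carries P restricted to the triangulations starting
   with s to a multiple of P restricted to those starting with s', and preserves A. *)
Lemma prefix_exchange (A : set LTmeas) s s' : measurable A -> tail_set A ->
  lorentzian s -> lorentzian s' -> size s = size s' -> top_width s = top_width s' ->
  ((2 ^+ triangles s)%:E * P (A `&` starting s) = (2 ^+ triangles s')%:E * P (A `&` starting s'))%E.
Proof.
move=> mA tA ls ls' sz tw.
pose E := exchange ls' sz tw.
have mE : measurable_fun [set: LTmeas] (E : LTmeas -> LTmeas) := measurable_exchange ls' sz tw.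
have p0 n : (0 <= 2 ^+ n :> R) by exact: exprn_ge0.
pose m1 : {measure set LTmeas -> \bar R} :=
  measure_function_pushforward__canonical__measure_function_Measure
    (mscale (NngNum (p0 (triangles s))) (mrestr P (measurable_starting s))) mE.
pose m2 : {measure set LTmeas -> \bar R} :=
  mscale (NngNum (p0 (triangles s'))) (mrestr P (measurable_starting s')).
have m1E B : m1 B = ((2 ^+ triangles s)%:E * P (E @^-1` B `&` starting s))%E by [].
have m2E B : m2 B = ((2 ^+ triangles s')%:E * P (B `&` starting s'))%E by [].
have m12 B : measurable B -> m1 B = m2 B.
  apply: eq_LT_measure.
    by rewrite m1E preimage_setT setTI law// -EFinM ltry.
  move=> u lu; rewrite m1E m2E.
  (* The rescaled mass of a cylinder extending [v] depends on [v] only through its top width. *)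
  have pw (v : seq (seq bool)) r : lorentzian (v ++ r) ->
      ((2 ^+ triangles v)%:E * P (starting (v ++ r)) =
       ((top_width (v ++ r))%:R * 2^-1 ^+ triangles r)%:E)%E.
    move=> lvr; rewrite law// -EFinM triangles_cat exprD; congr EFin.
    have h : 2 ^+ triangles v * 2^-1 ^+ triangles v = 1 :> R.
      by rewrite -exprMn divff ?expr1n// pnatr_eq0.
    by rewrite mulrCA [X in _ * X]mulrA h mul1r.
  (* If [u] is no longer than [s], the exchanged triangulation starts with [u] for all T starting
     with [s] or for none. A longer [u] must extend [s'], and its preimage is the cylinder of [s]
     followed by the rest of [u]. *)
  have [us|su] := leqP (size u) (size s).
    have [uE|uN] := eqVneq (take (size u) s') u.
      rewrite (_ : E @^-1` starting u `&` starting s = starting s); last first.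
        apply/seteqP; split => T //=; first by case.
        move=> Ts; split=> //; rewrite /starting /= -[RHS]uE.
        have := mkseq_exchange ls' sz tw 0 Ts; rewrite addn0 /= cats0 => <-.
        by rewrite /mkseq -map_take take_iota (minn_idPl us).
      rewrite startingI -?sz// uE eqxx.
      have := pw s [::]; rewrite cats0 => ->//; have := pw s' [::]; rewrite cats0 => ->//.
      by rewrite tw.
    rewrite startingI -?sz// (negbTE uN) measure0 mule0 (_ : _ `&` _ = set0) ?measure0 ?mule0//.
    apply/seteqP; split => T //= -[Tu Ts]; move/eqP: uN; apply.
    have := mkseq_exchange ls' sz tw 0 Ts; rewrite addn0 /= cats0 => <-.
    by rewrite -[RHS]Tu /mkseq -map_take take_iota (minn_idPl us).
  have szu : size u = (size s + (size u - size s))%N by rewrite subnKC// ltnW.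
  rewrite [starting u `&` _]setIC startingI -?sz ?(ltnW su)//.
  have [uE|uN] := eqVneq (take (size s) u) s'; last first.
    rewrite measure0 mule0 (_ : _ `&` _ = set0) ?measure0 ?mule0//.
    apply/seteqP; split => T //= -[Tu Ts]; move/eqP: uN; apply.
    by rewrite -Tu szu mkseq_exchange// sz take_size_cat.
  have uD : u = s' ++ drop (size s) u by rewrite -{1}uE cat_take_drop.
  have lsu : lorentzian (s ++ drop (size s) u).
    by apply: (lorentzian_swap ls (esym tw)); rewrite -uD.
  rewrite (_ : _ `&` _ = starting (s ++ drop (size s) u)); last first.
    apply/seteqP; split => T /=.
      move=> [Tu Ts]; rewrite /starting /= size_cat size_drop /mkseq iotaD map_cat add0n.
      congr (_ ++ _); first exact: Ts.
      by rewrite -[in RHS]Tu szu mkseq_exchange// sz drop_size_cat// -sz addKn.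
    rewrite /starting /= size_cat size_drop => Tsu.
    have /andP[/eqP Ts /eqP Tu] : (mkseq T (size s) == s) &&
        (map T (iota (size s) (size u - size s)) == drop (size s) u).
      by rewrite -eqseq_cat ?size_mkseq// -map_cat -[X in _ ++ iota X _]add0n -iotaD; apply/eqP.
    split=> //; rewrite {1}szu mkseq_exchange// Tu.
    by rewrite -uD.
  rewrite pw//; have -> : P (starting u) = P (starting (s' ++ drop (size s) u)) by rewrite -uD.
  by rewrite pw -?uD// (top_width_swap _ tw) -uD.
rewrite -m2E -m12// m1E.
congr (_ * P _)%E; apply/seteqP; split => T /= [AT Ts]; split=> //.
  by apply: (tA _ _ (size s)) AT => j nj; rewrite exchange_in// ltnNge nj.
by apply: (tA _ _ (size s)) AT => j nj; rewrite exchange_in// ltnNge nj.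
Qed.

Lemma probability_children (A : set LTmeas) s : measurable A -> lorentzian s ->
  P (A `&` starting s) = (\esum_(w in children s) P (A `&` starting (rcons s w)))%E.
Proof.
move=> mA ls; rewrite -esum_measure; last 2 first.
- by move=> w; apply: measurableI => //; exact: measurable_starting.
- move=> w w' _ _ [T [[_ Tw] [_ Tw']]]; move: Tw Tw'.
  by rewrite /starting /= !size_rcons => -> /rcons_inj[].
congr (P _); apply/seteqP; split => T.
  move=> [AT Ts]; exists (T (size s)).
    have := stripP T (size s).+1; rewrite mkseqS Ts lorentzian_rcons.
    by move=> /and3P[_ ? /eqP ?].
  by split=> //; rewrite /starting /= size_rcons mkseqS Ts.
move=> [w _ [AT]]; rewrite /starting /= size_rcons mkseqS => /rcons_inj[Ts _].
by split.
Qed.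

(* Lorentzian only for m > 0. *)
Definition thin_top M m : seq (seq bool) :=
  rcons (nseq M [:: true; false]) (true :: nseq m false).

Lemma lorentzian_thin M : lorentzian (nseq M [:: true; false]).
Proof.
have := stripP (MkLT thin_LT_subproof) M; rewrite (_ : mkseq _ M = nseq M [:: true; false])//.
apply: (@eq_from_nth _ [::]); rewrite size_mkseq ?size_nseq// => i iM.
by rewrite nth_mkseq// nth_nseq iM.
Qed.

Lemma top_width_thin M : top_width (nseq M [:: true; false]) = 1%N.
Proof. by rewrite /top_width; elim: M => // M; case: M. Qed.

Lemma top_width_thin_top M m : top_width (thin_top M m) = m.
Proof. by rewrite /thin_top top_width_rcons /downs /= count_nseq mul1n. Qed.

Lemma lorentzian_thin_top M m : (0 < m)%N -> lorentzian (thin_top M m).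
Proof.
move=> m0; rewrite lorentzian_rcons lorentzian_thin top_width_thin /strip_ok /=.
by rewrite /downs /ups /= !count_nseq /= mul0n mul1n add0n m0.
Qed.

Lemma size_thin_top M m : size (thin_top M m) = M.+1.
Proof. by rewrite size_rcons size_nseq. Qed.

Section tail_event.
Variable A : set LTmeas.
Hypotheses (mA : measurable A) (tA : tail_set A).

(** This is a(M + 1, m): [thin_top M m] has M + 1 strips. By [weightE] any other triangulation with
    the same height and top width gives the same value. *)
Definition weight M m : R :=
  2 ^+ triangles (thin_top M m) * fine (P (A `&` starting (thin_top M m))).

Lemma probability_fineK s : (fine (P (A `&` starting s)))%:E = P (A `&` starting s).
Proof.
by rewrite fineK// fin_num_measure//; apply: measurableI => //; exact: measurable_starting.
Qed.

Lemma weight_ge0 M m : 0 <= weight M m.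
Proof. by rewrite mulr_ge0// ?exprn_ge0// fine_ge0. Qed.

Lemma weight0 M : weight M 0 = 0.
Proof.
rewrite /weight (_ : starting _ = set0) ?setI0 ?measure0 ?mulr0//.
apply/seteqP; split => T //= Ts; have := stripP T (size (thin_top M 0)).
by rewrite Ts lorentzian_rcons => /and3P[_ /andP[]].
Qed.

Lemma weightE s M : lorentzian s -> size s = M.+1 ->
  P (A `&` starting s) = (2^-1 ^+ triangles s * weight M (top_width s))%:E.
Proof.
move=> ls sM; have := prefix_exchange mA tA ls (lorentzian_thin_top M (top_width_gt0 ls)).
rewrite size_thin_top top_width_thin_top => /(_ sM erefl).
rewrite -(probability_fineK s) -(probability_fineK (thin_top _ _)) -!EFinM => -[e].
congr EFin; rewrite /weight -e mulrA.
by rewrite -exprMn mulVf ?expr1n ?mul1r// pnatr_eq0.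
Qed.

(** Condition on the next strip, whose word is one generation of the process. *)
Lemma offspring_weight M m : offspring m (EFin \o weight M.+1) = (weight M m)%:E.
Proof.
case: (posnP m) => [->|m0]; first by rewrite /= !weight0.
have lt := lorentzian_thin_top M m0.
rewrite -{1}(top_width_thin_top M m) -esum_children//; last 2 first.
- by move=> x; rewrite lee_fin weight_ge0.
- by rewrite /= weight0.
rewrite [weight M m]/weight EFinM probability_fineK probability_children//.
rewrite -esumZl ?exprn_ge0//.
apply: eq_esum => w [ow uw].
rewrite (@weightE _ M.+1); last 2 first.
- by rewrite lorentzian_rcons lt ow uw eqxx.
- by rewrite size_rcons size_thin_top.
rewrite top_width_rcons triangles_rcons exprD -!EFinM; congr EFin.
have h : 2 ^+ triangles (thin_top M m) * 2^-1 ^+ triangles (thin_top M m) = 1 :> R.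
  by rewrite -exprMn divff ?expr1n// pnatr_eq0.
by rewrite !mulrA h mul1r.
Qed.

(** Each generation replaces q by 1 / (2 - q) and M + 1 by M, so the induction on k is uniform in M.
    For q = 0 a term survives only when the other group is empty. *)
Lemma superadditive_weight k M : superadditive (extinction k) (weight M).
Proof.
elim: k M => [|k IH] M.
  move=> x y; rewrite /extinction mul0r !expr0n.
  case: x y => [|x] [|y]; rewrite /= ?(weight0, mulr0, mul0r, mulr1, mul1r, addr0, add0r, addn0)//.
  exact: weight_ge0.
rewrite -extinctionS; apply: superadditive_offspring (IH M.+1) => //.
- exact: extinction01.
- exact: weight_ge0.
- exact: weight_ge0.
- by move=> m; exact: offspring_weight.
Qed.

Lemma weight_linear M m : m%:R * weight M 1 <= weight M m.
Proof.
apply: superadditive_limit; last exact: weight0.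
by move=> k; exact: superadditive_weight.
Qed.

End tail_event.

Lemma weightC (A : set LTmeas) M m : measurable A -> tail_set A ->
  weight A M m + weight (~` A) M m = m%:R.
Proof.
move=> mA tA; case: (posnP m) => [->|m0]; first by rewrite !weight0 addr0.
rewrite /weight -mulrDr; set s := thin_top M m.
have -> : fine (P (A `&` starting s)) + fine (P (~` A `&` starting s)) = m%:R * 2^-1 ^+ triangles s.
  apply: EFin_inj; rewrite EFinD !probability_fineK//; last exact: measurableC.
  rewrite -measureU; last 3 first.
  - by apply: measurableI => //; exact: measurable_starting.
  - by apply: measurableI; [exact: measurableC|exact: measurable_starting].
  - by rewrite setIACA setICr set0I.
  rewrite -setIUl setUv setTI.
  by have := law (lorentzian_thin_top M m0); rewrite top_width_thin_top.
by rewrite mulrCA -exprMn divff ?expr1n ?mulr1// pnatr_eq0.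
Qed.

(* weight_linear for A and for its complement, whose weights add up to m, is an equality. *)
Lemma tail_independent (A : set LTmeas) M s : measurable A -> tail_set A ->
  lorentzian s -> size s = M.+1 -> P (A `&` starting s) = ((weight A M 1)%:E * P (starting s))%E.
Proof.
move=> mA tA ls sM; rewrite (weightE mA tA ls sM) law// -EFinM; congr EFin.
set m := top_width s.
have h1 := weight_linear mA tA M m.
have h2 := weight_linear (measurableC mA) (tail_setC tA) M m.
have hm := weightC M m mA tA.
have := congr1 ( *%R m%:R) (weightC M 1 mA tA); rewrite mulr1 mulrDr => h.
have -> : weight A M m = m%:R * weight A M 1 by lra.
by ring.
Qed.

Lemma zero_one_law (A : set LTmeas) : measurable A -> tail_set A ->
  P A = 0%E \/ P A = 1%E.
Proof.
move=> mA tA.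
pose D M := [set s | lorentzian s /\ size s = M.+1].
have part (B : set LTmeas) M : measurable B -> P B = (\esum_(s in D M) P (B `&` starting s))%E.
  move=> mB; rewrite -esum_measure; last 2 first.
  - by move=> s; apply: measurableI => //; exact: measurable_starting.
  - by move=> s s' [_ sM] [_ s'M] [T [[_ Ts] [_ Ts']]]; rewrite -Ts -Ts' sM s'M.
  congr (P _); apply/seteqP; split => T; last by move=> [s _ []].
  move=> BT; exists (mkseq T M.+1); first by split; [exact: stripP|rewrite size_mkseq].
  by split=> //; rewrite /starting /mkset size_mkseq.
(* Summing over all beginnings of height M + 1 identifies the factor of [tail_independent] as the
   probability of [A], whatever M. *)
have PA M : P A = (weight A M 1)%:E.
  rewrite (part A M)// (eq_esum (b := fun s => ((weight A M 1)%:E * P (starting s))%E)); last first.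
    by move=> s [ls sM]; exact: tail_independent.
  rewrite esumZl ?weight_ge0//.
  have := part setT M measurableT; under eq_esum do rewrite setTI.
  by move=> <-; rewrite probability_setT mule1.
pose a := NngNum (weight_ge0 A 0 1).
pose m1 : {measure set LTmeas -> \bar R} := mrestr P mA.
pose m2 : {measure set LTmeas -> \bar R} := mscale a P.
have m1E B : m1 B = P (B `&` A) by [].
have m2E B : m2 B = ((weight A 0 1)%:E * P B)%E by [].
(* Independence passes from cylinders to all events, in particular to [A], which gives P(A) =
   P(A)^2. *)
have ind : m1 A = m2 A.
  apply: eq_LT_measure => //.
    by rewrite m1E setTI (PA 0%N) ltry.
  move=> s ls; rewrite m1E m2E setIC.
  case: s ls => [|w s] ls.
    by rewrite starting_nil setIT probability_setT mule1 (PA 0%N).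
  by rewrite (@tail_independent _ (size s))// -!PA.
move: ind; rewrite m1E m2E setIid (PA 0%N) -EFinM => -[] /eqP.
rewrite -subr_eq0 -{1}[weight A 0 1]mulr1 -mulrBr mulf_eq0 => /orP[/eqP ->|]; first by left.
by rewrite subr_eq0 => /eqP <-; right.
Qed.

End zero_one.

(** * The critical inverse temperature *)

Section critical_temperature.
Context {R : realType}.
Implicit Types (T : LT) (beta : R).

Definition unmagnetized beta : set LTmeas :=
  [set T : LT | no_magnetization (R := R) T beta].

Lemma unmagnetized_tail beta : 0 <= beta -> tail_set (unmagnetized beta).
Proof.
move=> b0 T T' n TT'; apply: (@no_magnetization_tail R T T' n beta) => //.
- exact: matching_LT.
- exact: matching_LT.
- by move=> j nj; rewrite TT'.
Qed.

Lemma measurable_unmagnetized beta : measurable (unmagnetized beta).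
Proof.
(* A pair that is not a vertex of T imposes no condition. *)
pose X j i k N : set LTmeas := [set T : LT | (i < ups (T j))%N ->
  `|gap T beta N (allup [:: (j, i)])| <= k.+1%:R^-1].
have mX j i k N : measurable (X j i k N).
  (* The first j + 1 strips give the width of the level j, and the first N give the gap. *)
  apply: (@measurable_prefix_determined (j.+1 + N)) => T T' /eq_mkseq TT'.
  rewrite /X /= -TT' ?ltn_addr// => XT /XT; rewrite /gap -!(@eq_layer_avg _ T T')//;
    by move=> m mN; rewrite TT'// ltn_addl.
have -> : unmagnetized beta =
    \bigcap_j \bigcap_i \bigcap_k \bigcup_n \bigcap_m X j i k (n + m)%N.
  apply/seteqP; split => T.
    move=> noM j _ i _ k _.
    have [ij|ij] := boolP (i < ups (T j))%N; last by exists 0%N => // m _ /(negP ij).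
    have := noM (j, i) ij => /cvgr0Pnorm_le/(_ k.+1%:R^-1) []; first by rewrite invr_gt0.
    by move=> n _ hn; exists n => // m _ _; apply: hn => /=; exact: leq_addr.
  move=> XT [j i] ij; apply/cvgr0Pnorm_le => eps eps0.
  have [k _ /(_ k (leqnn k)) /= keps] := near_infty_natSinv_lt (PosNum eps0).
  have [n _ hn] := XT j I i I k I.
  exists n => // N /= nN; apply: le_trans (ltW keps).
  by rewrite -(subnKC nN); exact: hn.
apply: bigcapT_measurable => j; apply: bigcapT_measurable => i.
apply: bigcapT_measurable => k; apply: bigcupT_measurable => n.
by apply: bigcapT_measurable => m; exact: mX.
Qed.

Lemma beta_c_ge0 T : (0 <= beta_c R T)%E.
Proof.
apply: ereal_sup_ubound; exists 0 => //; split => //.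
by apply/unique_gibbsP => //; exact: no_magnetization0.
Qed.

(* Uniqueness is inherited by smaller inverse temperatures, so the rational ones determine
   the supremum. *)
Lemma le_beta_c T T' :
  (forall q : rat, 0 <= ratr q :> R -> unmagnetized (ratr q) T -> unmagnetized (ratr q) T') ->
  (beta_c R T <= beta_c R T')%E.
Proof.
move=> TT'; apply: ge_ereal_sup => _ [b [b0 /(unique_gibbsP T b0) ub] <-].
rewrite leNgt; apply/negP => cb.
have := beta_c_ge0 T'; case cE : (beta_c R T') => [r| |] //; last first.
  by rewrite cE in cb; rewrite ltNge leey in cb.
rewrite lee_fin => r0; rewrite cE lte_fin in cb.
have [q] := rat_in_itvoo cb; rewrite in_itv /= => /andP[rq qb].
have q0 : 0 <= ratr q :> R by exact: le_trans r0 (ltW rq).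
have uq : unmagnetized (ratr q) T.
  by apply: no_magnetization_mono ub; rewrite q0 ltW.
have : ((ratr q)%:E <= beta_c R T')%E.
  apply: ereal_sup_ubound; exists (ratr q) => //; split => //.
  by apply/unique_gibbsP => //; exact: TT'.
by rewrite cE lee_fin leNgt rq.
Qed.

End critical_temperature.

Unset Implicit Arguments.

Theorem theorem5 (R : realType) (P : probability LTmeas R)
    (hP : is_LT_weak_limit (mu_cr R) P) :
  exists c : \bar R, (0 <= c)%E /\ {ae P, forall T : LT, beta_c R T = c}.
Proof.
have law := LT_law hP.
(* The exceptional event at the rational q is whichever of the event and its complement is null by
   the zero-one law. *)
pose exc (q : rat) : set LTmeas :=
  if `[< P (unmagnetized (ratr q : R)) = 1%E >] then ~` unmagnetized (ratr q : R)
  else unmagnetized (ratr q : R).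
have excP (q : rat) : 0 <= ratr q :> R -> P.-negligible (exc q).
  move=> q0; have mU := measurable_unmagnetized (ratr q : R).
  rewrite /exc; case: asboolP => PU.
    apply/negligibleP; first exact: measurableC.
    by apply: etrans (probability_setC P mU) _; rewrite PU subee.
  apply/negligibleP => //.
  by have [] := zero_one_law law mU (unmagnetized_tail q0).
(* Only nonnegative inverse temperatures are kept, since tail invariance is established for them. *)
pose F n : set LTmeas :=
  if unpickle n is Some q then (if 0 <= ratr q :> R then exc q else set0) else set0.
pose N := \bigcup_n F n.
have negN : P.-negligible N.
  apply: negligible_bigcup => n; rewrite /F; case: unpickle => [q|]; last exact: negligible_set0.
  by case: ifPn => [|_]; [exact: excP|exact: negligible_set0].
(* Off [N], all triangulations are unmagnetized at the same nonnegative rationals. *)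
have agree T T' : ~ N T -> ~ N T' -> (beta_c R T <= beta_c R T')%E.
  move=> NT NT'; apply: le_beta_c => q q0.
  have nexc T1 : ~ N T1 -> ~ exc q T1.
    move=> NT1 eT1; apply: NT1; exists (pickle q); first exact: I.
    by rewrite /F pickleK q0.
  have := nexc _ NT; have := nexc _ NT'; rewrite /exc; case: asboolP => _ // h _ _.
  exact: contrapT.
have [T0 NT0] : exists T0 : LT, ~ N T0.
  apply: contrapT => /forallNP NT.
  have NE : N = setT by apply/seteqP; split => // T _; exact: contrapT (NT T).
  rewrite NE in negN; have P0 := measure_negligible measurableT negN.
  by have /eqP := etrans (esym (probability_setT P)) P0; rewrite onee_eq0.
exists (beta_c R T0); split; first exact: beta_c_ge0.
apply: negligibleS negN => T /= cT; apply: contrapT => NT; apply: cT.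
by apply/eqP; rewrite eq_le !agree.
Qed.
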